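(* Consider the Bayesian game described in the context. Suppose that for every $i\in N$ the following conditions hold. (a) $u_i(a,\theta)$ is continuous over $\mathcal{A}\times\Theta$, and for each $f_{-i}\in\mathcal{F}_{-i}$ and $\theta_i\in\Theta_i$, $\rho_i(\cdot,f_{-i},\theta_i)$ is strictly quasi-concave on $\mathcal{A}_i$. (b) For every measurable set $S\subset\Theta_{-i}$, $\eta_i(S|\theta_i)$ is continuous in $\theta_i$. (c) There exist positive constants $\alpha$ and $\nu$ such that for all $f_{-i}\in\mathcal{F}_{-i}$ and $\theta_i\in\Theta_i$, $$-\rho_i(a_i',f_{-i},\theta_i)\ \ge\ -v_i(f_{-i},\theta_i)+\alpha\, d\big(a_i',A_i^*(f_{-i},\theta_i)\big)^{\nu},\qquad \forall a_i'\in\mathcal{A}_i,$$ where $v_i(f_{-i},\theta_i):=\max_{a_i\in\mathcal{A}_i}\rho_i(a_i,f_{-i},\theta_i)$ and $A_i^*(f_{-i},\theta_i):=\arg\max_{a_i\in\mathcal{A}_i}\rho_i(a_i,f_{-i},\theta_i)$. (d) There exists a constant $\tau_i>0$ such that for any $a_i\in\mathcal{A}_i$, $f_{-i}\in\mathcal{F}_{-i}$ and $\theta_i,\theta_i'\in\Theta_i$, $$|\rho_i(a_i,f_{-i},\theta_i)-\rho_i(a_i,f_{-i},\theta_i')|\le\tau_i\|\theta_i-\theta_i'\|.$$ (e) $\mathcal{A}_i$ and $\Theta_i$ are compact and convex. Then there exists $f=(f_1,\ldots,f_n)\in\mathcal{F}$ such that $$f_i(\theta_i)\in\arg\max_{a_i\in\mathcal{A}_i}\rho_i(a_i,f_{-i},\theta_i),\qquad\forall\theta_i\in\Theta_i,\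 i\in N,$$ and the behavioural functions $f_1,\ldots,f_n$ are equi-continuous, i.e., for every $\epsilon>0$ there is $\delta>0$ such that for all $i\in N$, $\|f_i(\theta_i')-f_i(\theta_i'')\|\le\epsilon$ whenever $\theta_i',\theta_i''\in\Theta_i$ and $\|\theta_i'-\theta_i''\|<\delta$.
   Context: Bayesian game: there are $n$ players, $N=\{1,\ldots,n\}$. For each $i$, the type set $\Theta_i\subset\mathbb{R}^{d_i}$ and the action space $\mathcal{A}_i\subset\mathbb{R}^{z_i}$ are non-empty. Put $\Theta=\Theta_1\times\cdots\times\Theta_n$, $\mathcal{A}=\mathcal{A}_1\times\cdots\times\mathcal{A}_n$; the subscript $-i$ denotes the vector (or product) over all players except $i$. Player $i$ has utility $u_i(a,\theta)=u_i(a_i,a_{-i},\theta_i,\theta_{-i})$. The types $\theta$ have joint probability distribution $\eta$ on $\Theta$; $\eta_i(\cdot|\theta_i)$ denotes the conditional probability distribution of $\theta_{-i}$ on $\Theta_{-i}$ given $\theta_i$ (specified for every $\theta_i\in\Theta_i$). $\mathcal{F}_i$ is the set of (measurable) functions $f_i:\Theta_i\to\mathcal{A}_i$ (called behavioural functions), with the infinity norm; $\mathcal{F}=\mathcal{F}_1\times\cdots\times\mathcal{F}_n$, and $\mathcal{F}_{-i}$ is the product over $j\ne i$. For $a_i\in\mathcal{A}_i$, $f_{-i}\in\mathcal{F}_{-i}$, $\theta_i\in\Theta_i$, $$\rho_i(a_i,f_{-i},\theta_i):=\int_{\Theta_{-i}}u_i(a_i,f_{-i}(\theta_{-i}),\theta_i,\theta_{-i})\,d\eta_i(\theta_{-i}|\theta_i).$$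 $\|\cdot\|$ is the Euclidean norm and $d(x,B)=\inf_{b\in B}\|x-b\|$. A function $h$ on a convex set is strictly quasi-concave if $h(tx+(1-t)y)>\min\{h(x),h(y)\}$ for $x\neq y$, $t\in(0,1)$. *)

(* Defs.v *)
From HB Require Import structures.
From mathcomp Require Import all_boot all_order all_algebra.
From mathcomp Require Import all_classical all_reals all_analysis.
From mathcomp Require Import measurable_realfun.

Set Implicit Arguments.
Unset Strict Implicit.
Unset Printing Implicit Defensive.

Import Order.TTheory GRing.Theory Num.Theory.
Import numFieldNormedType.Exports.

Local Open Scope classical_set_scope.
Local Open Scope ring_scope.

(* The library norm on ['rV[R]_k] is the maximum norm, which induces the same
   topology; distances are measured here with the Euclidean norm. *)
Definition eucl_norm (R : realType) (k : nat) (x : 'rV[R]_k) : R :=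
  Num.sqrt (\sum_j x 0 j ^+ 2).

Definition eucl_dist (R : realType) (k : nat) (x : 'rV[R]_k) (B : set 'rV[R]_k)
    : R :=
  inf [set eucl_norm (x - b) | b in B].

Definition argmax (R : realType) (T : Type) (C : set T) (h : T -> R) : set T :=
  [set a | C a /\ forall b, C b -> h b <= h a].

(* The value 0 is taken only if no maximizer exists. *)
Definition maxval (R : realType) (T : Type) (C : set T) (h : T -> R) : R :=
  xget 0 (h @` argmax C h).

Definition strictly_quasi_concave (R : realType) (k : nat) (C : set 'rV[R]_k)
    (h : 'rV[R]_k -> R) : Prop :=
  forall x y : 'rV[R]_k, C x -> C y -> x != y ->
  forall t : R, 0 < t < 1 ->
    Num.min (h x) (h y) < h (t *: x + (1 - t) *: y).

Definition borel (T : ptopologicalType) := g_sigma_algebraType (@open T).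

HB.instance Definition _ (I : Type) (T : I -> ptopologicalType) :=
  Pointed.copy (prod_topology T) (forall i : I, T i).

(* Families (x_j)_(j in I) with x_j in R^(k j), with the product topology. *)
Definition profile (R : realType) (I : Type) (k : I -> nat)
    : ptopologicalType :=
  prod_topology (fun j : I => 'rV[R]_(k j) : ptopologicalType).

Definition others (n : nat) (i : 'I_n) : Type := {j : 'I_n | j != i}.

Definition drop_player (n : nat) (T : 'I_n -> Type) (i : 'I_n)
    (x : forall j, T j) : forall j : others i, T (sval j) :=
  fun j => x (sval j).
Arguments drop_player {n} T i x j.

(* The full profile (x_i, y_(-i)). *)
Definition join_player (n : nat) (T : 'I_n -> Type) (i : 'I_n) (x : T i)
    (y : forall j : others i, T (sval j)) : forall j, T j :=
  fun j => match eqVneq j i with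
           | EqNotNeq e => ecast l (T l) (esym e) x
           | NeqNotEq ne => y (exist _ j ne)
           end.

Lemma join_player_same (n : nat) (T : 'I_n -> Type) (i : 'I_n) (x : T i)
    (y : forall j : others i, T (sval j)) : join_player x y i = x.
Proof.
rewrite /join_player; case: eqVneq => [e|ne]; last by case/eqP: (ne).
by rewrite (eq_irrelevance e erefl).
Qed.

Lemma join_player_other (n : nat) (T : 'I_n -> Type) (i : 'I_n) (x : T i)
    (y : forall j : others i, T (sval j)) (j : others i) :
  join_player x y (sval j) = y j.
Proof.
case: j => j hj /=; rewrite /join_player; case: eqVneq => [e|ne].
  by case/eqP: (hj).
by congr (y (exist _ j _)); exact: bool_irrelevance.
Qed.

(* [is_conditional Ti Tmi i eta etai]: the family [etai] is a version of the
   conditional distribution of theta_(-i) given theta_i when theta has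
   distribution [eta]; [Ti] and [Tmi] are the type sets of player i and of the
   other players. *)
Definition is_conditional (R : realType) (n : nat) (d : 'I_n -> nat)
    (i : 'I_n) (Ti : set 'rV[R]_(d i))
    (Tmi : set (profile R (fun j : others i => d (sval j))))
    (eta : probability (borel (profile R d)) R)
    (etai : 'rV[R]_(d i) ->
       probability (borel (profile R (fun j : others i => d (sval j)))) R)
    : Prop :=
  [/\ forall ti, Ti ti -> etai ti Tmi = 1%E,
      forall S : set (borel (profile R (fun j : others i => d (sval j)))),
        measurable S -> S `<=` Tmi ->
        measurable_fun (Ti : set (borel 'rV[R]_(d i)))
          (fun ti => etai ti S)
    & forall (E : set (borel 'rV[R]_(d i)))
        (S : set (borel (profile R (fun j : others i => d (sval j))))),
        measurable E -> E `<=` Ti -> measurable S -> S `<=` Tmi ->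
        eta [set t | E (t i) /\ S (drop_player (fun j => 'rV[R]_(d j)) i t)]
        = (\int[eta]_(t in [set t | E (t i)]) etai (t i) S)%E].

Unset Implicit Arguments.

(* Probability distributions on Theta (resp. Theta_(-i)) are Borel
   probabilities on the ambient space giving mass 1 to that set. *)
Record bayesian_game (R : realType) (n : nat) : Type := BayesianGame {
  tdim : 'I_n -> nat;
  adim : 'I_n -> nat;
  tset : forall i, set 'rV[R]_(tdim i);
  aset : forall i, set 'rV[R]_(adim i);
  tset_nonempty : forall i, tset i !=set0;
  aset_nonempty : forall i, aset i !=set0;
  tset_measurable : forall i, measurable (tset i : set (borel 'rV[R]_(tdim i)));
  (* only the values on (product of [aset]) x (product of [tset]) matter *)
  utility : 'I_n -> profile R adim * profile R tdim -> R;
  prior : probability (borel (profile R tdim)) R;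
  prior_tset : prior [set t | forall j, tset j (t j)] = 1%E;
  belief : forall i, 'rV[R]_(tdim i) ->
    probability (borel (profile R (fun j : others i => tdim (sval j)))) R;
  beliefP : forall i,
    is_conditional (tset i) [set t | forall j : others i, tset (sval j) (t j)]
      prior (belief i)
}.

Arguments tdim {R n} G j : rename.
Arguments adim {R n} G j : rename.
Arguments tset {R n} G i _ : rename.
Arguments aset {R n} G i _ : rename.
Arguments utility {R n} G i _ : rename.
Arguments prior {R n} G : rename.
Arguments belief {R n} G i ti : rename.

Section Game.
Variables (R : realType) (n : nat) (G : bayesian_game R n).

Definition type_profiles : set (profile R (tdim G)) :=
  [set t | forall j, tset G j (t j)].

Definition action_profiles : set (profile R (adim G)) :=
  [set a | forall j, aset G j (a j)].

Definition other_types (i : 'I_n)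
    : set (profile R (fun j : others i => tdim G (sval j))) :=
  [set t | forall j, tset G (sval j) (t j)].

(* Behavioural functions are total functions on the ambient space, of which
   only the values on the type set matter. *)
Definition behaviour (i : 'I_n) : set ('rV[R]_(tdim G i) -> 'rV[R]_(adim G i)) :=
  [set f | measurable_fun
             (tset G i : set (borel 'rV[R]_(tdim G i)))
             (f : borel 'rV[R]_(tdim G i) -> borel 'rV[R]_(adim G i))
           /\ forall t, tset G i t -> aset G i (f t)].

Definition other_behaviours (i : 'I_n)
    : set (forall j : others i,
             'rV[R]_(tdim G (sval j)) -> 'rV[R]_(adim G (sval j))) :=
  [set f | forall j, behaviour (sval j) (f j)].

Definition rho (i : 'I_n) (ai : 'rV[R]_(adim G i))
    (f : forall j : others i, 'rV[R]_(tdim G (sval j)) -> 'rV[R]_(adim G (sval j)))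
    (ti : 'rV[R]_(tdim G i)) : R :=
  \int[belief G i ti]_(t in other_types i)
    utility G i
      (join_player (T := fun j => 'rV[R]_(adim G j)) ai (fun j => f j (t j)),
       join_player (T := fun j => 'rV[R]_(tdim G j)) ti t).

Definition best_value (i : 'I_n)
    (f : forall j : others i, 'rV[R]_(tdim G (sval j)) -> 'rV[R]_(adim G (sval j)))
    (ti : 'rV[R]_(tdim G i)) : R :=
  maxval (aset G i) (fun ai => rho i ai f ti).

Definition best_responses (i : 'I_n)
    (f : forall j : others i, 'rV[R]_(tdim G (sval j)) -> 'rV[R]_(adim G (sval j)))
    (ti : 'rV[R]_(tdim G i)) : set 'rV[R]_(adim G i) :=
  argmax (aset G i) (fun ai => rho i ai f ti).

End Game.

Arguments type_profiles {R n} G _.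
Arguments action_profiles {R n} G _.
Arguments other_types {R n} G i _.
Arguments behaviour {R n} G i _.
Arguments other_behaviours {R n} G i _.
Arguments rho {R n} G i ai f ti.
Arguments best_value {R n} G i f ti.
Arguments best_responses {R n} G i f ti _.

(* Main.v *)
Require Import Defs.
From mathcomp Require Import all_boot all_order all_algebra.
From mathcomp Require Import all_classical all_reals all_analysis.
From mathcomp Require Import measurable_realfun.
From mathcomp Require Import finmap zify ring lra.
Import Order.TTheory GRing.Theory Num.Theory.
Import numFieldNormedType.Exports.

(** An equilibrium is a fixed point of the map [reply] that sends a profile of
    strategies to the profile of best responses to it.  Strict quasi-concavity
    makes the best response single-valued.  The growth condition makes it
    stable ([best_response_stable]): if two payoff functions on the action set
    differ by at most [e], their maximizers are at distance at most
    (2 e / alpha) ^ (1 / nu).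

    This estimate is used twice.  Applied to two types of the same player,
    whose payoffs differ by at most tau times the distance of the types, it
    gives every best response the same modulus of continuity, whatever the
    opponents do; so [reply] maps the set [equi_strategies] of profiles with
    this modulus into itself.  Applied to two nearby profiles of
    [equi_strategies] it shows that [reply] is continuous on this set for the
    topology of pointwise convergence.  The payoffs of nearby profiles are
    indeed close: on an equicontinuous family of functions, evaluation is
    jointly continuous in the function and the point, so the integrand of
    [rho] is jointly continuous, and the type sets are compact
    ([rho_continuous]).  For pointwise convergence [equi_strategies] is
    compact by the theorem of Tychonoff on products, and it is convex.  A
    fixed point of [reply] is an equilibrium, and inherits the modulus, which
    is the required equicontinuity.

    The fixed point comes from [tychonoff_fixpoint], the theorem of Tychonoff
    for a compact convex subset of a power of the reals.  Its finite core,
    [finite_best_approximation], finds for points y_1, ..., y_m of the set a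
    point x which is at least as close to T x as every y_k.  To get it, let
    C_k consist of the weights l for which y_k is closest to the image of the
    combination of the y_i with weights l; the closed sets C_k cover the
    simplex, so some l belongs to C_k for every k with l_k > 0
    ([simplex_complementarity], a companion of the lemma of Knaster,
    Kuratowski and Mazurkiewicz), and convexity of the distance does the rest.
    Compactness replaces finitely many points by all points of the set, among
    them T x itself, and finitely many coordinates by all of them.

    The covering statement follows from a combinatorial lemma of Scarf
    ([scarf]) applied to finer and finer grids of the simplex.  That lemma
    needs only finitely many total orders and a labelling, and is proved by a
    parity argument like the lemma of Sperner, without triangulations. *)

(** * Scarf's lemma on dominant sets *)

Section DominantSets.
Variables (Y I : finType) (r : I -> Y -> nat).
Hypothesis r_inj : forall i, injective (r i).

Definition dominant (S : {set Y}) : bool :=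
  [forall y, [exists i, [forall s in S, r i y <= r i s]]].

Lemma dominantP (S : {set Y}) :
  reflect (forall y, exists i, forall s, s \in S -> r i y <= r i s) (dominant S).
Proof.
apply: (iffP forallP) => domS y.
  have /existsP[i /forallP iP] := domS y; exists i => s sS.
  by have /implyP/(_ sS) := iP s.
have [i iP] := domS y; apply/existsP; exists i.
by apply/forallP => s; apply/implyP => /iP.
Qed.

Lemma dominantS (S T : {set Y}) : S \subset T -> dominant T -> dominant S.
Proof.
move=> ST /dominantP domT; apply/dominantP => y.
by have [i iP] := domT y; exists i => s /(fintype.subsetP ST)/iP.
Qed.

(** The pivot step: a dominant set one element short of full size extends to a
    dominant set of full size in exactly two ways.  Sending an order to the
    least element of [T] maps the orders onto [T], and there is one order too
    many, so exactly two orders [i] and [j] share their least element.  Either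
    of them can be freed, and the element to add is then the largest one, for
    the freed order, among those above the least element of [T] in all the
    other orders. *)
Lemma card_dominant_extension (T : {set Y}) (t0 : Y) :
    t0 \in T -> dominant T -> #|T|.+1 = #|I| ->
    (forall i, exists y, forall k, k != i -> exists2 s, s \in T & r k s < r k y) ->
  #|[set y | (y \notin T) && dominant (y |: T)]| = 2.
Proof.
move=> t0T /dominantP domT cardT roomM.
pose m i := [arg min_(s < t0 | s \in T) r i s].
have mT i : m i \in T by rewrite /m; case: arg_minnP.
have m_le i s : s \in T -> r i (m i) <= r i s.
  by rewrite /m; case: arg_minnP => // z _ + sT; exact.
have m_eq i s : s \in T -> r i s <= r i (m i) -> m i = s.
  by move=> sT les; apply: (@r_inj i); apply/eqP; rewrite eqn_leq les m_le.
have m_onto s : s \in T -> exists l, m l = s.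
  by move=> sT; have [l lP] := domT s; exists l; apply: m_eq => //; exact: lP.
(* the candidates for an extension that frees the order [k] *)
pose M k y := [forall (l | l != k), r l (m l) < r l y].
have MP k y : reflect (forall l, l != k -> r l (m l) < r l y) (M k y).
  apply: (iffP forallP) => H l; first by move=> lk; have /implyP/(_ lk) := H l.
  by apply/implyP => /H.
have exM k : exists y, M k y.
  have [y yP] := roomM k; exists y; apply/MP => l /yP[s sT].
  exact: leq_ltn_trans (m_le _ _ sT).
have exTop k : {y | M k y & forall z, M k z -> r k z <= r k y}.
  have Mch := xchooseP (exM k).
  exists [arg max_(y > xchoose (exM k) | M k y) r k y]; case: arg_maxnP => //.
pose top k := s2val (exTop k).
have topM k : M k (top k) by exact: s2valP (exTop k).
have top_max k : forall z, M k z -> r k z <= r k (top k).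
  exact: s2valP' (exTop k).
(* the order [k] can be freed: the other orders still reach all of [T] *)
pose P k := forall s, s \in T -> exists2 l, l != k & m l = s.
have Pinj k : P k -> {in [set~ k] &, injective m}.
  move=> Pk; apply/imset_injP; rewrite cardsC1 -cardT /=.
  suff -> : m @: [set~ k] = T by [].
  apply/setP => s; apply/imsetP/idP => [[l _ ->]//|/Pk[l lk <-]].
  by exists l => //; rewrite !inE.
have P_top k : P k -> (top k \notin T) && dominant (top k |: T).
  move=> Pk; apply/andP; split.
    apply/negP => /Pk[l lk ml]; have /MP/(_ l lk) := topM k.
    by rewrite ml ltnn.
  apply/dominantP => y; have [|/MP nM] := boolP (M k y); last first.
    have [l lk ley] : exists2 l, l != k & r l y <= r l (m l).
      apply/exists_inP; apply: contra_notT nM; rewrite negb_exists_in.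
      by move=> /forall_inP nM l /nM; rewrite -ltnNge.
    exists l => s; rewrite !inE => /orP[/eqP ->|sT].
      by apply: leq_trans ley _; apply: ltnW; apply/MP: lk.
    exact: leq_trans ley (m_le _ _ sT).
  move=> My; exists k => s; rewrite !inE => /orP[/eqP ->|sT].
    exact: top_max.
  have [l lP] := domT y; have [<-|lk] := eqVneq l k; first exact: lP.
  have := lP _ (mT l); rewrite leqNgt; move/MP: My => /(_ _ lk) -> //.
have top_P y : y \notin T -> dominant (y |: T) -> exists2 k, P k & y = top k.
  move=> yT /dominantP domyT.
  have [k kP] := domyT y.
  (* [k] has the new element as its least one, so the other orders serve [T] *)
  have old s : s \in T -> exists l, [/\ l != k, m l = s & r l s <= r l y].
    move=> sT; have [l lP] := domyT s; exists l; split.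
    - apply: contraNneq yT => lk; rewrite lk in lP.
      suff -> : y = s by [].
      apply: (@r_inj k); apply/eqP; rewrite eqn_leq kP ?lP ?inE ?eqxx //.
      by rewrite sT orbT.
    - by apply: m_eq => //; apply: lP; rewrite inE mT orbT.
    - by apply: lP; rewrite !inE eqxx.
  have Pk : P k by move=> s /old[l [lk ml _]]; exists l.
  exists k => //; apply: (@r_inj k); apply/eqP; rewrite eqn_leq.
  apply/andP; split.
    apply: top_max; apply/MP => l lk; have [l' [l'k ml' ley]] := old _ (mT l).
    have ll' : l' = l by apply: (Pinj _ Pk); rewrite ?inE.
    rewrite ltn_neqAle; rewrite ll' in ley; rewrite ley andbT.
    by apply: contraNneq yT => /r_inj <-.
  have [l lP] := domyT (top k).
  have [lk|lk] := eqVneq l k; first by rewrite -{1 3}lk lP // !inE eqxx.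
  have /MP/(_ _ lk) := topM k; rewrite ltnNge lP // !inE.
  by rewrite mT orbT.
have [i [j ij mij]] : exists i, exists2 j, i != j & m i = m j.
  apply/injectivePn; apply/negP => /injectiveP m_inj.
  have : #|m @: [set: I]| <= #|T|.
    by apply/subset_leq_card/fintype.subsetP => _ /imsetP[l _ ->].
  by rewrite card_imset // cardsT -cardT ltnn.
have Pi : P i.
  move=> s /m_onto[l <-]; have [->|li] := eqVneq l i; last by exists l.
  by exists j; rewrite ?mij // eq_sym.
have Pj : P j.
  move=> s /m_onto[l <-]; have [->|lj] := eqVneq l j; last by exists l.
  by exists i; rewrite ?mij.
have P_ij k : P k -> (k == i) || (k == j).
  move=> Pk; apply: contraNT ij; rewrite negb_or => /andP[ki kj].
  by apply/eqP; apply: (Pinj _ Pk); rewrite ?inE 1?eq_sym.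
suff -> : [set y | (y \notin T) && dominant (y |: T)] = [set top i; top j].
  (* if they were equal, this element would exceed all minima, against dominance *)
  rewrite cards2; suff -> : top i != top j by [].
  apply/negP => /eqP tij; have [l lP] := domT (top i).
  have := lP _ (mT l); rewrite leqNgt => /negP; apply.
  have [->|li] := eqVneq l i; last by move/MP: (topM i); apply.
  by rewrite tij; move/MP: (topM j); apply.
apply/setP => y; rewrite !inE; apply/idP/idP.
  by case/andP => yT /(top_P _ yT)[k /P_ij/orP[]/eqP -> ->]; rewrite eqxx ?orbT.
by move=> /orP[] /eqP ->; exact: P_top.
Qed.

End DominantSets.

Section ScarfLabelling.
Variables (X I : finType) (r : I -> X -> nat) (c : X -> I).
Hypothesis r_inj : forall i, injective (r i).

(** One slack element per order is added, so that all the sets to be compared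
    have the same size: the slack element [inr i] is the least one for the
    order [i] and lies above all of [X] for the other orders.  In a dominant
    set, [inr i] records that the order [i] is not used. *)
Definition slack_rank (i : I) (y : X + I) : nat :=
  match y with
  | inl x => (r i x).+1
  | inr j => if j == i then 0 else (\max_x r i x + enum_rank j).+2
  end.

Definition slack_label (y : X + I) : I :=
  match y with inl x => c x | inr i => i end.

Lemma slack_rank_inj i : injective (slack_rank i).
Proof.
have rmax x : r i x <= \max_x r i x by exact: (leq_bigmax x).
case=> [x|j] [x'|j'] //=.
- by move=> [] /r_inj ->.
- by case: eqP => // _ [] E; have := rmax x; rewrite E; lia.
- by case: eqP => // _ [] E; have := rmax x'; rewrite -E; lia.
case: eqP => [->|_]; case: eqP => [->|_] // [] /addnI.
by move/ord_inj/enum_rank_inj => ->.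
Qed.

Local Notation dom := (dominant _ _ slack_rank).

(** Double counting, as in the lemma of Sperner.  A room is a dominant set of
    full size; a door is a set one element short with all labels except [i0].
    A room has exactly one door if it carries all labels, and otherwise none
    or two.  By the pivot step every door leads to none or two rooms, except
    the set [S0] of all slack elements but [inr i0], which leads to one.
    Hence the number of rooms with all labels is odd. *)
Lemma rainbow_dominant (x0 : X) (i0 : I) :
  exists S : {set X + I}, dom S /\ slack_label @: S = [set: I].
Proof.
pose door (T : {set X + I}) :=
  (#|T|.+1 == #|I|) && (slack_label @: T == [set~ i0]).
pose room (S : {set X + I}) := (#|S| == #|I|) && dom S.
have count_pairs :
  \sum_(S | room S) #|[set y in S | door (S :\ y)]| =
  \sum_(T | door T) #|[set y | (y \notin T) && dom (y |: T)]|.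
  transitivity (\sum_(S | room S) \sum_(y in S | door (S :\ y)) 1).
    by apply: eq_bigr => S _; rewrite sum1dep_card.
  rewrite (exchange_big_dep xpredT) //=.
  transitivity
    (\sum_(T | door T) \sum_(y | (y \notin T) && dom (y |: T)) 1); last first.
    by apply: eq_bigr => S _; rewrite sum1dep_card.
  rewrite [RHS](exchange_big_dep xpredT) //=; apply: eq_bigr => y _.
  rewrite (reindex_onto (fun T => y |: T) (fun S => S :\ y)) /=; last first.
    by move=> S /andP[_ /andP[yS _]]; rewrite finset.setD1K.
  apply: eq_bigl => T; rewrite /room !inE eqxx /=.
  have [yT|yT] := boolP (y \in T) => /=.
    rewrite andbF; apply/negbTE/negP => /andP[_ /eqP E].
    by move: yT; rewrite -E !inE eqxx.
  rewrite finset.setU1K // eqxx andbT cardsU1 yT add1n /door.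
  by case: (_.+1 == _); rewrite //= andbC.
pose S0 : {set X + I} := [set inr i | i in [set~ i0]].
have inlS0 x : (inl x \in S0) = false by apply/negbTE/negP => /imsetP[].
have inrS0 i : (inr i \in S0) = (i != i0).
  by rewrite mem_imset ?inE //; exact: inr_inj.
have Igt0 : 0 < #|I| by apply/card_gt0P; exists i0.
have doorS0 : door S0.
  rewrite /door card_imset; last exact: inr_inj.
  rewrite cardsC1 prednK // eqxx /=; apply/eqP/setP => k.
  apply/imsetP/idP => [[y /imsetP[l lP ->] ->]//|ki].
  by exists (inr k); rewrite // mem_imset //; exact: inr_inj.
(* only the largest element of [X] for the order [i0] can be added to [S0] *)
have degS0 : #|[set y | (y \notin S0) && dom (y |: S0)]| = 1.
  have [xm _ xmP] := @arg_maxnP X x0 xpredT (r i0) isT.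
  rewrite -[RHS](cards1 (inl xm : X + I)); congr #|pred_of_set _|; apply/setP => y.
  rewrite !inE; apply/idP/eqP => [/andP[yS /dominantP domy]|->].
    case: y yS domy => [x _ domx|i]; last first.
      rewrite inrS0 negbK => /eqP -> domy; exfalso.
      have [k /(_ (inr k))] := domy (inl x0).
      have kS : inr k \in inr i0 |: S0.
        by rewrite !inE inrS0; case: (eqVneq k i0) => [->|]; rewrite ?eqxx ?orbT.
      by rewrite /= eqxx => /(_ kS).
    have [k kP] := domx (inl xm).
    have ki0 : k = i0.
      apply/eqP; apply/negPn/negP => ki0.
      by have := kP (inr k); rewrite !inE inrS0 ki0 /= eqxx => /(_ isT).
    have := kP (inl x); rewrite !inE eqxx /= ki0 => /(_ isT) lex.
    by congr inl; apply: (@r_inj i0); have := xmP x isT; lia.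
  rewrite inlS0 /=; apply/dominantP => -[x|i]; last first.
    by exists i => s _ /=; rewrite eqxx.
  exists i0 => -[x'|j]; rewrite !inE ?inlS0 ?inrS0 ?orbF.
    by move=> /eqP[->] /=; apply: xmP.
  rewrite orFb => /negbTE ji /=; rewrite ji.
  by have : r i0 x <= \max_x r i0 x by [exact: (leq_bigmax x)]; lia.
(* another door contains an element of [X], which [inr i] exceeds in all
   orders but [i], so the pivot step applies *)
have degT T : door T -> T != S0 ->
    2 %| #|[set y | (y \notin T) && dom (y |: T)]|.
  move=> /andP[/eqP cardT /eqP colT] TS0.
  have [x xT] : exists x, inl x \in T.
    apply/existsP; apply: contraNT TS0; rewrite negb_exists => /forallP noX.
    apply/eqP/setP => -[x|i]; first by rewrite inlS0 (negbTE (noX x)).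
    rewrite inrS0 -in_setC1 -colT; apply/idP/imsetP => [iT|[[x|j] + ->]//].
      by exists (inr i).
    by rewrite (negbTE (noX x)).
  have [domT|ndomT] := boolP (dom T); last first.
    rewrite (_ : [set y | _] = finset.set0) ?cards0 //; apply/setP => y; rewrite !inE.
    apply/negbTE; apply: contra ndomT => /andP[_]; apply: dominantS.
    exact: finset.subsetUr.
  rewrite (card_dominant_extension _ _ _ slack_rank_inj _ _ xT) //.
  move=> i; exists (inr i) => k ki; exists (inl x) => //=.
  rewrite eq_sym (negbTE ki).
  by have : r k x <= \max_x r k x by [exact: (leq_bigmax x)]; lia.
(* the two doors of a room without [i0] omit one of two elements of equal label *)
have degS S : room S -> slack_label @: S != [set: I] ->
    2 %| #|[set y in S | door (S :\ y)]|.
  move=> /andP[/eqP cardS _] notrainbow.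
  have [->|] := eqVneq [set y in S | door (S :\ y)] finset.set0.
    by rewrite cards0.
  case/set0Pn => y0; rewrite inE => /andP[y0S doory0].
  have door_inj y : door (S :\ y) -> {in S :\ y &, injective slack_label}.
    move=> /andP[/eqP cardSy /eqP colSy]; apply/imset_injP.
    by rewrite colSy cardsC1 -cardSy.
  have /andP[_ /eqP col0] := doory0.
  have y0i0 : slack_label y0 != i0.
    apply: contraNneq notrainbow => y0i0; apply/eqP/setP => k; rewrite inE.
    have [->|ki0] := eqVneq k i0; first by rewrite -y0i0; exact: imset_f.
    have : k \in slack_label @: (S :\ y0) by rewrite col0 !inE.
    by apply/fintype.subsetP/imsetS/subD1set.
  have : slack_label y0 \in slack_label @: (S :\ y0) by rewrite col0 !inE.
  case/imsetP => y1; rewrite !inE => /andP[y10 y1S] E.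
  suff -> : [set y in S | door (S :\ y)] = [set y0; y1].
    by rewrite cards2 eq_sym y10.
  apply/setP => y; rewrite !inE; apply/idP/idP.
    case/andP => yS doory; apply: contraNT y10; rewrite negb_or => /andP[y_0 y_1].
    by apply/eqP; apply: (door_inj _ doory) => //; rewrite !inE eq_sym ?y_0 ?y_1.
  case/orP => /eqP ->; rewrite ?y0S ?y1S //= /door.
  have cardD1 : #|S :\ y1|.+1 = #|I| by rewrite -cardS (cardsD1 y1 S) y1S.
  rewrite cardD1 eqxx /=; apply/eqP/setP => k.
  apply/idP/idP => [/imsetP[z + ->]|].
    rewrite !inE => /andP[_ zS]; have [-> //|zy0] := eqVneq z y0.
    suff : slack_label z \in [set~ i0] by rewrite !inE.
    by rewrite -col0 imset_f // !inE zy0.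
  rewrite -col0 => /imsetP[z]; rewrite !inE => /andP[zy0 zS] ->.
  have [->|zy1] := eqVneq z y1.
    by rewrite -E imset_f // !inE eq_sym y10.
  by rewrite imset_f // !inE zy1.
have [S /andP[roomS /eqP colS]|norainbow] :=
    pickP [pred S | room S && (slack_label @: S == [set: I])].
  by exists S; split => //; case/andP: roomS.
have : 2 %| \sum_(S | room S) #|[set y in S | door (S :\ y)]|.
  apply: dvdn_sum => S roomS; apply: degS => //.
  by have := norainbow S; rewrite /= roomS => /= ->.
rewrite count_pairs (bigD1 S0) //= degS0 dvdn_addl // dvdn_sum // => T.
by move=> /andP[doorT TS0]; apply: degT.
Qed.

(** The orders that matter are exactly the labels of [D]: the slack elements of
    a dominant set with all labels account for the other ones. *)
Lemma scarf (x0 : X) (i0 : I) :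
  exists2 D : {set X}, D != finset.set0 &
    forall x, exists2 i, i \in c @: D & forall d, d \in D -> r i x <= r i d.
Proof.
have [S [/dominantP domS colS]] := rainbow_dominant x0 i0.
have key x : exists2 d, inl d \in S &
    forall s, s \in S -> slack_rank (c d) (inl x) <= slack_rank (c d) s.
  have [i iP] := domS (inl x).
  have : i \in slack_label @: S by rewrite colS inE.
  case/imsetP => -[d dS E|j jS E]; first by exists d => //; rewrite E in iP.
  by have := iP _ jS; rewrite E /= eqxx.
exists [set d | inl d \in S].
  by have [d dS _] := key x0; apply/set0Pn; exists d; rewrite inE.
move=> x; have [d dS dP] := key x; exists (c d); first by rewrite imset_f // inE.
by move=> d'; rewrite inE => /dP.
Qed.

End ScarfLabelling.

(** * A complementarity theorem for closed covers of the simplex *)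

(** Barycentric coordinates, multiplied by [N.+1] to make them integers. *)
Definition grid (I : finType) (N : nat) : finType :=
  {x : {ffun I -> 'I_N.+2} | \sum_i x i == N.+1}.

Lemma grid_ext (I : finType) (N : nat) (g : I -> nat) (i0 : I) :
  \sum_i g i <= N.+1 -> exists x : grid I N, forall i, g i <= sval x i.
Proof.
move=> leg; pose h i := g i + (i == i0) * (N.+1 - \sum_i g i).
have sumh : \sum_i h i = N.+1.
  rewrite big_split /= [X in _ + X](bigD1 i0) //= eqxx mul1n [X in _ + (_ + X)]big1.
    by rewrite addn0 subnKC.
  by move=> i /negbTE ->.
have leh i : h i < N.+2 by rewrite ltnS -sumh (bigD1 i) // leq_addr.
pose x : {ffun I -> 'I_N.+2} := [ffun i => Ordinal (leh i)].
have xP : \sum_i x i == N.+1.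
  by rewrite -[X in _ == X]sumh; apply/eqP/eq_bigr => i _; rewrite ffunE.
by exists (exist _ x xP) => i; rewrite /= ffunE /= leq_addr.
Qed.

(** Ordering the grid by each coordinate, a dominant set has small diameter: if
    the least coordinates for its labels left enough room, raising all of them
    by one would give a grid point that contradicts dominance.  For the same
    reason the coordinates that are not labels are small. *)
Lemma scarf_grid (I : finType) (N : nat) (i0 : I) (c : grid I N -> I) :
  exists2 D : {set grid I N}, D != finset.set0 &
    forall d, d \in D -> forall i,
      (forall d', d' \in D -> sval d' i <= sval d i + #|I|) /\
      (#|I| <= sval d i -> i \in c @: D).
Proof.
(* the rank in the enumeration breaks ties between equal coordinates *)
pose X : finType := grid I N.
pose r (i : I) (x : X) := sval x i * #|X| + enum_rank x.
have r_inj i : injective (r i).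
  move=> x y /(congr1 (modn^~ #|X|)); rewrite !modnMDl !modn_small //.
  by move/ord_inj/enum_rank_inj.
have r_le i x y : r i x <= r i y -> sval x i <= sval y i.
  move/(leq_div2r #|X|); have X0 : 0 < #|X| by apply/card_gt0P; exists x.
  by rewrite !divnMDl // !divn_small // !addn0.
have [x0 _] : exists x : X, forall i, 0 <= sval x i.
  by apply: (grid_ext _ _ (fun=> 0) i0); rewrite big1.
have [D /set0Pn[d0 d0D] DP] := scarf _ _ _ c r_inj x0 i0.
exists D; first by apply/set0Pn; exists d0.
pose low i := [arg min_(d < d0 | d \in D) sval d i].
have lowD i : low i \in D by rewrite /low; case: arg_minnP.
have low_le i d : d \in D -> sval (low i) i <= sval d i.
  by rewrite /low; case: arg_minnP => // z _ + dD; exact.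
pose e i := if i \in c @: D then nat_of_ord (sval (low i) i) else 0.
have e_le i d : d \in D -> e i <= sval d i.
  by rewrite /e; case: ifP => // _; exact: low_le.
have sum_e : N.+1 < \sum_i e i + #|I|.
  apply: (@leq_trans (\sum_(i in c @: D) (sval (low i) i).+1)); last first.
    rewrite -big_mkcond /= -sum1_card; under eq_bigr do rewrite -addn1.
    by rewrite big_split /= leq_add2l big_mkcond /= leq_sum // => i _; case: ifP.
  rewrite ltnNge; apply/negP; rewrite big_mkcond /= => /grid_ext-/(_ i0)[x xP].
  have [i iC iP] := DP x; have := r_le _ _ _ (iP _ (lowD i)).
  by have := xP i; rewrite iC => /leq_trans/[apply]; rewrite ltnn.
have near_e d i : d \in D -> sval d i < e i + #|I|.
  move=> dD; have sum_d : \sum_i sval d i = N.+1 by exact/eqP/(svalP d).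
  have : \sum_i (sval d i - e i) + \sum_i e i = N.+1.
    rewrite -big_split /= -[RHS]sum_d; apply: eq_bigr => j _.
    by rewrite subnK // e_le.
  rewrite (bigD1 i) //= => sum_N; rewrite -ltn_subLR ?e_le //.
  rewrite -(ltn_add2r (\sum_i e i)) [ltnRHS]addnC; apply: leq_trans sum_e.
  by rewrite ltnS -[leqRHS]sum_N leq_add2r leq_addr.
move=> d dD i; split=> [d' d'D|].
  by apply: ltnW; apply: leq_trans (near_e _ _ d'D) _; rewrite leq_add2r e_le.
have := near_e _ i dD; rewrite /e; case: ifP => // _.
by rewrite add0n ltnNge => /negbTE ->.
Qed.

Local Open Scope classical_set_scope.
Local Open Scope ring_scope.

Lemma ptws_coord_continuous (J : choiceType) (V : topologicalType) (j : J) :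
  continuous (fun x : {ptws J -> V} => x j).
Proof. exact: (@proj_continuous J (fun=> V) j). Qed.

Lemma ptws_box_compact (R : realType) (J : choiceType) (M : J -> R) :
  compact [set x : {ptws J -> R} | forall j, `|x j| <= M j].
Proof.
have -> : [set x : {ptws J -> R} | forall j, `|x j| <= M j] =
    [set x : {ptws J -> R} | forall j, `[- M j, M j]%classic (x j)].
  by apply/seteqP; split => x /= H j; have := H j; rewrite in_itv /= ler_norml.
apply: (@tychonoff J (fun=> R) (fun j => `[- M j, M j]%classic)) => j.
exact: segment_compact.
Qed.

Definition simplex (R : realType) (I : finType) : set {ptws I -> R} :=
  [set l | (forall i, 0 <= l i) /\ \sum_i l i = 1].

Lemma cvg_sumr (R : realType) (T : Type) (F : set_system T) (I : Type)
    (s : seq I) (f : I -> T -> R) (l : I -> R) :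
    Filter F -> (forall i, f i @ F --> l i) ->
  (fun x => \sum_(i <- s) f i x) @ F --> \sum_(i <- s) l i.
Proof. by move=> FF fl; apply: cvg_big => //; exact: add_continuous. Qed.

Lemma closed_le_fun (R : realType) (T : topologicalType) (f g : T -> R) :
  continuous f -> continuous g -> closed [set x | f x <= g x].
Proof.
move=> fc gc.
rewrite (_ : [set x | _] = (fun x => g x - f x) @^-1` [set y | 0 <= y]).
  apply: closed_comp; last exact: closed_ge.
  by move=> x _; apply: continuousB; [exact: gc|exact: fc].
by apply/seteqP; split => x /=; rewrite subr_ge0.
Qed.

Lemma simplex_compact (R : realType) (I : finType) : compact (simplex R I).
Proof.
have sum_cont : continuous (fun l : {ptws I -> R} => \sum_i l i).
  move=> l; apply: (@cvg_sumr _ _ (nbhs l) _ _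
    (fun i (x : {ptws I -> R}) => x i) (fun i => l i)) => i.
  exact: (@ptws_coord_continuous I R i l).
apply: (@subclosed_compact _ _ [set x : {ptws I -> R} | forall j, `|x j| <= 1]).
- have -> : simplex R I =
      (\bigcap_(i : I) [set l : {ptws I -> R} | 0 <= l i]) `&`
      [set l : {ptws I -> R} | \sum_i l i <= 1] `&`
      [set l : {ptws I -> R} | 1 <= \sum_i l i].
    apply/seteqP; split => l /=.
      move=> [l0 l1]; rewrite l1 lexx.
      by split => //; split => // i _; exact: l0.
    move=> [[l0 le1] ge1]; split => [i|]; first exact: l0.
    by apply/eqP; rewrite eq_le le1.
  apply: closedI; [apply: closedI|].
  + apply: closed_bigI => i _; apply: closed_le_fun; first exact: cst_continuous.
    exact: ptws_coord_continuous.
  + by apply: closed_le_fun;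
      [exact: sum_cont|exact: cst_continuous].
  + by apply: closed_le_fun;
      [exact: cst_continuous|exact: sum_cont].
- exact: (@ptws_box_compact R I (fun=> 1)).
- move=> l [l0 l1] j; rewrite ger0_norm // -l1 (bigD1 j) //= lerDl.
  by apply: sumr_ge0 => i _.
Qed.

Lemma simplex_cover_near (R : realType) (I : finType) (i0 : I)
    (C : I -> set {ptws I -> R}) (N : nat) :
    (forall l, simplex R I l -> exists k, C k l) ->
  exists2 z : {ptws I -> R}, simplex R I z &
    forall i, #|I|%:R / N.+1%:R <= z i ->
    exists2 y, C i y & forall j, `|y j - z j| <= #|I|%:R / N.+1%:R.
Proof.
move=> cover; have N0 : (0 : R) < N.+1%:R by rewrite ltr0n.
pose pt (x : grid I N) : {ptws I -> R} := fun i => (sval x i)%:R / N.+1%:R.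
have pt_simplex x : simplex R I (pt x).
  split=> [i|]; first by rewrite divr_ge0.
  rewrite -mulr_suml -natr_sum (eqP (svalP x)) divff //.
pose c x := projT1 (cid (cover _ (pt_simplex x))).
have cP x : C (c x) (pt x) by rewrite /c; case: cid.
have [D /set0Pn[d0 d0D] DP] := scarf_grid I N i0 c.
exists (pt d0) => // i; rewrite ler_pM2r ?invr_gt0 // ler_nat => le_i.
have /imsetP[d dD iE] := (DP _ d0D i).2 le_i.
exists (pt d); first by rewrite iE; exact: cP.
move=> j; rewrite -mulrBl normrM [X in _ * X]ger0_norm ?invr_ge0 ?ler0n //.
rewrite ler_pM2r ?invr_gt0 // ler_norml lerBlDr -natrD ler_nat.
rewrite [(#|I| + _)%N]addnC (DP _ d0D j).1 // andbT.
by rewrite lerBrDr addrC lerBlDr -natrD ler_nat (DP _ dD j).1.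
Qed.

Lemma prod_topology_cvg (I : eqType) (V : I -> topologicalType)
    (F : set_system (prod_topology V)) (x : prod_topology V) :
  Filter F -> (forall i, (fun y : prod_topology V => y i) @ F --> x i) -> F --> x.
Proof.
move=> FF Fx; apply/cvg_sup => i; apply/cvg_image.
  apply/seteqP; split => // r _; exists (dfwith x i r) => //.
  by rewrite dfwithin.
move=> W /= /Fx FW; exists ((fun y : prod_topology V => y i) @^-1` W) => //.
apply/seteqP; split => [_ [y Wy <-] //|r Wr].
by exists (dfwith x i r); rewrite /= dfwithin.
Qed.

Lemma ptws_nbhs_ball (R : realType) (I : finType) (x : {ptws I -> R}) B :
  nbhs x B -> exists2 e : R, 0 < e &
    forall y : {ptws I -> R}, (forall i, `|y i - x i| < e) -> B y.
Proof.
move=> xB.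
pose G : set_system {ptws I -> R} := filter_from [set e : R | 0 < e]
  (fun e => [set y | forall i, `|y i - x i| < e]).
have GF : Filter G.
  apply: filter_from_filter; first by exists 1; rewrite /= ltr01.
  move=> e f /= e0 f0; exists (Num.min e f); first by rewrite /= lt_min e0.
  by move=> y /= yP; split => i; have := yP i; rewrite lt_min => /andP[].
suff /(_ _ xB)[e e0 eB] : G --> x by exists e => // y yP; exact: eB.
apply: prod_topology_cvg => i; apply/cvgrPdist_lt => e e0.
by exists e => // y /(_ i); rewrite distrC.
Qed.

(** Cluster point, along finer grids, of one point of each dominant set: a
    coordinate which is positive in the limit is eventually a label, hence
    points of the corresponding closed set are arbitrarily close. *)
Lemma simplex_complementarity (R : realType) (I : finType) (i0 : I)
    (C : I -> set {ptws I -> R}) :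
    (forall k, closed (C k)) -> (forall l, simplex R I l -> exists k, C k l) ->
  exists2 l, simplex R I l & forall k, 0 < l k -> C k l.
Proof.
move=> Ccl cover.
pose z N := projT1 (cid2 (simplex_cover_near R I i0 C N cover)).
have zS N : simplex R I (z N) by rewrite /z; case: cid2.
have zP N : forall i, #|I|%:R / N.+1%:R <= z N i ->
    exists2 y, C i y & forall j, `|y j - z N j| <= #|I|%:R / N.+1%:R.
  by rewrite /z; case: cid2.
have [l [lS lcl]] : simplex R I `&` cluster (z @ \oo) !=set0.
  by apply: simplex_compact; exists 0%N => // N _; exact: zS.
exists l => // k lk; apply: Ccl => B /ptws_nbhs_ball[e e0 eB].
pose d := Num.min (e / 2) (l k / 2).
have d0 : 0 < d by rewrite lt_min !divr_gt0.
have [N0 N0P] : exists N0, forall N, (N0 <= N)%N -> #|I|%:R / N.+1%:R < d.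
  exists (Num.bound (#|I|%:R / d)) => N N0N; rewrite ltr_pdivrMr ?ltr0n //.
  rewrite mulrC -ltr_pdivrMr //.
  apply: (lt_le_trans (archi_boundP _)); first by rewrite divr_ge0 // ltW.
  by rewrite ler_nat ltnW.
have zl : nbhs l [set y : {ptws I -> R} | forall i, `|y i - l i| < d].
  apply: (@filter_forall _ I (fun i (y : {ptws I -> R}) => `|y i - l i| < d)
    _ (nbhs_filter l)) => i.
  have /cvgrPdist_lt/(_ _ d0) := @ptws_coord_continuous I R i l.
  by apply: filterS => y; rewrite distrC.
have zN0 : (z @ \oo) (z @` [set N | (N0 <= N)%N]).
  by exists N0 => // N /= ?; exists N.
have [_ [[N N0N <-] zNl]] := lcl _ _ zN0 zl.
have [|y Cy yz] := zP N k.
  apply: (le_trans (ltW (N0P _ N0N))); have := zNl k.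
  rewrite ltr_norml => /andP[+ _].
  have : d <= l k / 2 by rewrite ge_min lexx orbT.
  lra.
exists y; split => //; apply: eB => i.
apply: (le_lt_trans (ler_distD (z N i) _ _)); rewrite (splitr e).
have de : d <= e / 2 by rewrite ge_min lexx.
apply: ltrD; last exact: lt_le_trans (zNl i) de.
by apply: lt_le_trans de; apply: le_lt_trans (yz i) _; exact: N0P.
Qed.

(** * Tychonoff's fixed point theorem in a power of the reals *)

Lemma within_continuous_comp (S T U : topologicalType) (A : set S) (B : set T)
    (g : S -> T) (f : T -> U) :
  (forall x, A x -> B (g x)) -> {within A, continuous g} ->
  {within B, continuous f} -> {within A, continuous (f \o g)}.
Proof.
move=> AB /subspace_continuousP gc /subspace_continuousP fc.
apply/subspace_continuousP => x Ax; apply: cvg_comp (fc _ (AB _ Ax)).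
move=> W BW; have gW : nbhs x [set y | A y -> B (g y) -> W (g y)].
  exact: gc _ Ax _ BW.
apply: (@filterS _ (nbhs x) (nbhs_filter x) _ _ _ gW) => y gy Ay.
exact: gy Ay (AB y Ay).
Qed.

Lemma closed_within_le (R : realType) (T : topologicalType) (A : set T)
    (f g : T -> R) :
  closed A -> {within A, continuous f} -> {within A, continuous g} ->
  closed (A `&` [set x | f x <= g x]).
Proof.
move=> Acl /subspace_continuousP fc /subspace_continuousP gc x clx.
have Ax : A x by apply: Acl => W /clx [y [[Ay _] Wy]]; exists y.
split => //=; rewrite leNgt; apply/negP => gf.
have dc : (fun y => f y - g y) @ within A (nbhs x) --> f x - g x.
  by apply: cvgB; [exact: fc|exact: gc].
have fg_near : nbhs x [set y | A y -> 0 < f y - g y].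
  by apply: (@cvgr_gt _ _ _ _ _ _ dc 0); rewrite subr_gt0.
have [y [[Ay fgy] /(_ Ay)]] := clx _ fg_near.
by rewrite subr_gt0 ltNge => /negP; apply.
Qed.

Section FixedPoint.
Variables (R : realType) (J : choiceType).
Implicit Types (K : set {ptws J -> R}) (T : {ptws J -> R} -> {ptws J -> R}).

Definition pointwise_convex K := forall x y (t : R), K x -> K y ->
  0 <= t <= 1 -> K (fun j => t * x j + (1 - t) * y j).

Lemma pointwise_convex_sum K (I : finType) (y : I -> {ptws J -> R})
    (l : {ptws I -> R}) :
  pointwise_convex K -> (forall i, K (y i)) -> simplex R I l ->
  K (fun j => \sum_i l i * y i j).
Proof.
move=> Kc Ky [l0 l1].
have [i0 _] : exists i0 : I, true.
  apply: contrapT => noI; have : (0 : R) == 1.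
    by rewrite -l1 big1 // => i; case: noI; exists i.
  by rewrite eq_sym oner_eq0.
(* a base point [x] with weight [a] keeps the induction clear of zero weights *)
suff gen (s : seq I) (a : R) x : 0 <= a -> K x -> 0 < a + \sum_(i <- s) l i ->
    K (fun j => (a * x j + \sum_(i <- s) l i * y i j) / (a + \sum_(i <- s) l i)).
  have := gen (index_enum I) 0 _ (lexx _) (Ky i0); rewrite add0r l1 => /(_ ltr01).
  by congr (K _); apply/funext => j; rewrite mul0r add0r divr1.
elim: s a x => [|i s IH] a x a0 Kx.
  rewrite !big_nil addr0 => agt0; congr (K _) : Kx; apply/funext => j.
  by rewrite big_nil addr0 mulrAC divff ?mul1r // gt_eqF.
rewrite big_cons addrA => tot.
have [ai0|ai_gt0] := leP (a + l i) 0.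
  have a0' : a = 0 by have := l0 i; lra.
  have li0 : l i = 0 by have := l0 i; lra.
  rewrite a0' li0 !add0r in tot *.
  have := IH 0 x (lexx _) Kx; rewrite add0r => /(_ tot); congr (K _).
  by apply/funext => j; rewrite big_cons li0 !mul0r !add0r.
pose x' : {ptws J -> R} := fun j =>
  (a / (a + l i)) * x j + (1 - a / (a + l i)) * y i j.
have Kx' : K x'.
  apply: Kc => //; rewrite divr_ge0 ?(ltW ai_gt0) //=.
  by rewrite ler_pdivrMr // mul1r lerDl.
have := IH _ _ (ltW ai_gt0) Kx' tot; congr (K _); apply/funext => j.
rewrite big_cons addrA; congr (_ / _); congr (_ + _).
by rewrite /x'; field; rewrite gt_eqF.
Qed.

Variables (K : set {ptws J -> R}) (T : {ptws J -> R} -> {ptws J -> R}).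
Hypotheses (K0 : K !=set0) (Kcpt : compact K) (Kcvx : pointwise_convex K).
Hypothesis KT : forall x, K x -> K (T x).
Hypothesis Tc : forall j, {within K, continuous (fun x => T x j)}.

Let K_closed : closed K.
Proof.
apply: compact_closed => //.
by apply: (@hausdorff_product J (fun=> R)) => j; exact: Rhausdorff.
Qed.

(** Looking at finitely many coordinates [Z] only keeps this distance from [y]
    to [T x] finite and, in [x], continuous for pointwise convergence. *)
Definition gap (Z : seq J) (y x : {ptws J -> R}) : R := \sum_(j <- Z) `|y j - T x j|.

Let gap_continuous Z (y : {ptws J -> R} -> {ptws J -> R}) :
  (forall j, {within K, continuous (fun x => y x j)}) ->
  {within K, continuous (fun x => gap Z (y x) x)}.
Proof.
move=> yc; apply/subspace_continuousP => x Kx; apply: cvg_sumr => j.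
apply: cvg_norm; apply: cvgB.
  by have /subspace_continuousP := yc j; exact.
by have /subspace_continuousP := Tc j; exact.
Qed.

Let id_continuous j : {within K, continuous (fun x : {ptws J -> R} => x j)}.
Proof. by apply: continuous_subspaceT => x; exact: ptws_coord_continuous. Qed.

Let cst_coord_continuous (y : {ptws J -> R}) j :
  {within K, continuous (fun x : {ptws J -> R} => y j)}.
Proof. by apply: continuous_subspaceT => x; exact: cst_continuous. Qed.

(** A finite form of the best approximation theorem of Ky Fan: complementarity
    gives a combination of the [y i] using only those closest to its image,
    and the distance to this image is a convex function. *)
Lemma finite_best_approximation Z (I : finType) (i0 : I)
    (y : I -> {ptws J -> R}) :
  (forall i, K (y i)) -> exists2 x, K x & forall i, gap Z x x <= gap Z (y i) x.
Proof.
move=> Ky.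
pose comb (l : {ptws I -> R}) : {ptws J -> R} := fun j => \sum_i l i * y i j.
have Kcomb l : simplex R I l -> K (comb l) by exact: pointwise_convex_sum.
have combc : {within simplex R I, continuous comb}.
  apply: (@continuous_subspaceT _ _ (simplex R I) comb) => l.
  apply: (@prod_topology_cvg J (fun=> R) (comb @ nbhs l) (comb l)) => j.
  apply: (@cvg_sumr _ _ (nbhs l) _ _ (fun i (l : {ptws I -> R}) => l i * y i j)
    (fun i => l i * y i j)) => i.
  apply: (@cvgM _ _ (nbhs l) _ (fun l : {ptws I -> R} => l i) (fun=> y i j));
    last exact: cvg_cst.
  exact: (@ptws_coord_continuous I R i l).
have gapc i : {within simplex R I, continuous (fun l => gap Z (y i) (comb l))}.
  by apply: within_continuous_comp combc (gap_continuous Z (fun=> y i) _).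
have simplex_closed : closed (simplex R I).
  apply: compact_closed; last exact: simplex_compact.
  by apply: (@hausdorff_product I (fun=> R)) => j; exact: Rhausdorff.
pose C i := \bigcap_(k : I) (simplex R I `&`
  [set l | gap Z (y i) (comb l) <= gap Z (y k) (comb l)]).
have [||l lS lC] := simplex_complementarity R I i0 C.
- by move=> i; apply: closed_bigI => k _; exact: closed_within_le.
- move=> l lS.
  have [i _ iP] := @arg_minP _ _ I i0 xpredT (fun i => gap Z (y i) (comb l)) isT.
  by exists i => k _; split => //; exact: iP.
have [l0 l1] := lS.
exists (comb l); first exact: Kcomb.
move=> k; apply: (@le_trans _ _ (\sum_i l i * gap Z (y i) (comb l))).
  under [leRHS]eq_bigr do rewrite mulr_sumr.
  rewrite exchange_big /=; apply: ler_sum => j _.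
  have -> : comb l j - T (comb l) j = \sum_i l i * (y i j - T (comb l) j).
    under eq_bigr do rewrite mulrBr.
    by rewrite sumrB -mulr_suml l1 mul1r.
  apply: (le_trans (ler_norm_sum _ _ _)); apply: ler_sum => i _.
  by rewrite normrM ger0_norm.
rewrite -[leRHS]mul1r -l1 mulr_suml; apply: ler_sum => i _.
have := l0 i; rewrite le_eqVlt => /orP[/eqP <-|li]; first by rewrite !mul0r.
by apply: ler_wpM2l => //; have [] := lC _ li k Logic.I.
Qed.

(** Compactness is used a first time to compare [x] with all points of [K], and
    a second time to pass from finitely many coordinates to all of them. *)
Theorem tychonoff_fixpoint : exists2 x, K x & T x = x.
Proof.
(* by compactness, one [x] is as close to [T x] as every [y] of [K]; take [y = T x] *)
have Z_fix (Z : seq J) : exists2 x, K x & forall j, j \in Z -> T x j = x j.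
  have := Kcpt; rewrite compact_In0.
  move=> /(_ _ K (fun y => K `&` (K `&` [set x | gap Z x x <= gap Z y x])))[].
  - exists (fun y => K `&` [set x | gap Z x x <= gap Z y x]) => // y Ky.
    by apply: closed_within_le => //;
      [exact: (gap_continuous Z id)|exact: (gap_continuous Z (fun=> y))].
  - move=> D DK; have [x0 Kx0] := K0.
    pose y (i : option D) := if i is Some d then val d else x0.
    have [|x Kx xP] := finite_best_approximation Z _ None y.
      by case=> //= d; exact: set_mem (DK _ (valP d)).
    by exists x => d dD; split => //; split => //; exact: (xP (Some [` dD]%fset)).
  move=> x xP; have [x0 Kx0] := K0; have [Kx _] := xP _ Kx0.
  exists x => // j jZ; have [_ [_]] := xP _ (KT _ Kx).
  rewrite /= [leRHS]big1; last by move=> i _; rewrite subrr normr0.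
  rewrite /gap => gap0; apply/eqP; rewrite eq_sym -subr_eq0 -normr_le0.
  apply: le_trans gap0; rewrite (big_rem j) //= lerDl; apply: sumr_ge0 => i _.
  exact: normr_ge0.
have [[j0]|noJ] := pselect (inhabited J); last first.
  have [x Kx _] := Z_fix [::]; exists x => //; apply/funext => j.
  by case: noJ; constructor.
have := Kcpt; rewrite compact_In0.
move=> /(_ _ setT (fun j => K `&` ((K `&` [set x | T x j <= x j]) `&`
    (K `&` [set x : {ptws J -> R} | x j <= T x j]))))[].
- exists (fun j => ((K `&` [set x | T x j <= x j]) `&`
    (K `&` [set x : {ptws J -> R} | x j <= T x j]))) => // j _.
  by apply: closedI; apply: closed_within_le.
- move=> D _; have [x Kx xP] := Z_fix (enum_fset D).
  by exists x => j jD; split => //; split; split => //=; rewrite xP.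
move=> x xP; exists x; first by have [] := xP j0 I.
apply/funext => j; have [_ [[_ h1] [_ h2]]] := xP j I.
by apply/eqP; rewrite eq_le h1 h2.
Qed.
End FixedPoint.

(** * Continuity, measurability and integration on compact sets *)

(** Continuity in a parameter is uniform over a compact set; this turns joint
    continuity of an integrand into continuity of the integral, and joint
    continuity of payoffs into uniform closeness over all actions. *)
Lemma within_continuous_near_compact (R : realType) (X Y : topologicalType)
    (A : set X) (B : set Y) (f : X * Y -> R) (p : X) (e : R) :
  compact B -> {within A `*` B, continuous f} -> A p -> 0 < e ->
  \forall q \near within A (nbhs p), forall t, B t -> `|f (q, t) - f (p, t)| <= e.
Proof.
move=> /compact_near_coveringP/near_covering_withinP Bc.
move=> /subspace_continuousP fc Ap e0.
apply: (Bc X (within A (nbhs p)) (fun q t => `|f (q, t) - f (p, t)| <= e)) => t0 Bt0.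
have e2 : 0 < e / 2 by rewrite divr_gt0.
have /cvgrPdist_lt/(_ _ e2)[[U V] /= [pU tV] UV] := fc (p, t0) (conj Ap Bt0).
exists (V, [set q | A q /\ U q]) => /=.
  by split=> //; apply: (@filterS _ (nbhs p) (nbhs_filter p) _ _ _ pU) => q Uq Aq.
move=> [t q] /= [Vt [Aq Uq]] Bt.
have ft q' : A q' -> U q' -> `|f (p, t0) - f (q', t)| < e / 2.
  by move=> Aq' Uq'; exact: (UV (q', t) (conj Uq' Vt) (conj Aq' Bt)).
apply: (le_trans (ler_distD (f (p, t0)) _ _)); rewrite (splitr e) distrC.
by apply: lerD; apply: ltW; apply: ft => //; exact: nbhs_singleton.
Qed.

Lemma within_continuous_preimage (S T : topologicalType) (D : set S)
    (f : S -> T) (U : set T) :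
  {within D, continuous f} -> open U ->
  exists2 V, open V & D `&` f @^-1` U = D `&` V.
Proof.
move=> /continuousP fc /fc /open_subspaceP[V oV VE]; exists V => //.
by rewrite setIC -VE setIC.
Qed.

Lemma open_measurable_borel (T : ptopologicalType) (U : set T) :
  open U -> measurable (U : set (borel T)).
Proof. by move=> oU; exact: sub_sigma_algebra. Qed.

Lemma continuous_measurable_borel (S T : ptopologicalType) (D : set S)
    (f : S -> T) :
  {within D, continuous f} ->
  measurable_fun (D : set (borel S)) (f : borel S -> borel T).
Proof.
move=> fc mD; apply: (@measurability _ _ (borel S) (borel T) D f (@open T)) => //.
move=> _ [U oU <-].
have [V oV ->] := within_continuous_preimage _ _ _ _ _ fc oU.
by apply: measurableI => //; exact: open_measurable_borel.
Qed.

Lemma continuous_measurable_real (R : realType) (S : ptopologicalType)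
    (D : set S) (f : S -> R) :
  {within D, continuous f} -> measurable_fun (D : set (borel S)) (f : borel S -> R).
Proof.
move=> fc mD; apply: (measurability _ (RGenOpens.measurableE R)) => //.
move=> _ [_ [a [b ->]] <-].
have [V oV ->] := within_continuous_preimage _ _ _ _ _ fc (itv_open a b).
by apply: measurableI => //; exact: open_measurable_borel.
Qed.

Section CompactIntegral.
Variables (R : realType) (S : ptopologicalType) (P : probability (borel S) R).
Variable D : set S.
Hypotheses (mD : measurable (D : set (borel S))) (cD : compact D).

Lemma continuous_compact_integrable_borel (f : S -> R) :
  {within D, continuous f} -> P.-integrable (D : set (borel S)) (EFin \o f).
Proof.
move=> fc; apply: measurable_bounded_integrable => //.
- by apply: (le_lt_trans (probability_le1 P mD)); rewrite ltry.
- exact: continuous_measurable_real.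
- have /compact_bounded[M [Mreal fM]] := continuous_compact fc cD.
  by exists M; split=> // r Mr x Dx; apply: fM Mr _ _; exists x.
Qed.

Lemma Rintegral_dist_le (f g : S -> R) (e : R) : 0 <= e ->
  {within D, continuous f} -> {within D, continuous g} ->
  (forall x, D x -> `|f x - g x| <= e) ->
  `|\int[P]_(x in (D : set (borel S))) f x -
    \int[P]_(x in (D : set (borel S))) g x| <= e.
Proof.
move=> e0 fc gc fg.
have fi := continuous_compact_integrable_borel _ fc.
have gi := continuous_compact_integrable_borel _ gc.
rewrite -RintegralB //.
have fgi : P.-integrable (D : set (borel S)) (EFin \o (fun x => f x - g x)).
  apply: continuous_compact_integrable_borel.
  move=> x; apply: continuousB; [exact: fc|exact: gc].
apply: (le_trans (le_normr_Rintegral mD fgi)).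
apply: (@le_trans _ _ (\int[P]_(x in (D : set (borel S))) e)).
  apply: le_Rintegral => //.
  - apply: continuous_compact_integrable_borel => x.
    apply: cvg_norm; apply: cvgB; [exact: fc|exact: gc].
  - by apply: continuous_compact_integrable_borel => x; exact: cvg_cst.
rewrite Rintegral_cst // -[leRHS]mulr1; apply: ler_wpM2l => //.
rewrite -lee_fin fineK ?probability_le1 // fin_num_measure //.
Qed.

End CompactIntegral.

Lemma eucl_norm_ge0 (R : realType) k (x : 'rV[R]_k) : 0 <= eucl_norm x.
Proof. exact: sqrtr_ge0. Qed.

Lemma coord_le_eucl_norm (R : realType) k (x : 'rV[R]_k) c :
  `|x 0 c| <= eucl_norm x.
Proof.
rewrite -sqrtr_sqr /eucl_norm ler_wsqrtr // (bigD1 c) //= lerDl.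
by apply: sumr_ge0 => i _; exact: sqr_ge0.
Qed.

Lemma eucl_norm0 (R : realType) k : eucl_norm (0 : 'rV[R]_k) = 0.
Proof.
rewrite /eucl_norm big1 ?sqrtr0 // => i _.
by rewrite mxE expr0n.
Qed.

Lemma eucl_norm_continuous (R : realType) k : continuous (@eucl_norm R k).
Proof.
move=> x; apply: (@continuous_comp _ _ _ (fun x : 'rV[R]_k => \sum_j x 0 j ^+ 2)
  Num.sqrt); last exact: sqrt_continuous.
apply: (@cvg_sumr _ _ (nbhs x) _ _ (fun i (x : 'rV[R]_k) => x 0 i ^+ 2)
  (fun i => x 0 i ^+ 2)) => j.
apply: (@cvgM _ _ (nbhs x) _ (fun x : 'rV[R]_k => x 0 j) (fun x : 'rV[R]_k => x 0 j));
  exact: coord_continuous.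
Qed.

Lemma row_cvg (R : realType) k (T : Type) (F : set_system T)
    (f : T -> 'rV[R]_k) (x : 'rV[R]_k) : Filter F ->
  (forall c, (fun t => f t 0 c) @ F --> x 0 c) -> f @ F --> x.
Proof.
move=> FF fx; apply/cvgrPdist_le => e e0.
have : \forall t \near F, forall c, `|x 0 c - f t 0 c| <= e.
  by apply: filter_forall => c; have /cvgrPdist_le := fx c; apply.
apply: filterS => t ft; rewrite /Num.norm /= mx_normrE.
apply: bigmax_le; first exact: ltW.
by move=> [i c] _ /=; rewrite !mxE ord1; exact: ft.
Qed.

Lemma eucl_dist_set1 (R : realType) k (x a : 'rV[R]_k) :
  eucl_dist x [set a] = eucl_norm (x - a).
Proof. by rewrite /eucl_dist image_set1 inf1. Qed.

(** * Strategies with a common modulus of continuity *)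

Lemma powR_inv_le (R : realType) (a e nu : R) :
  0 <= a -> 0 <= e -> 0 < nu -> a <= e `^ nu -> a `^ nu^-1 <= e.
Proof.
move=> a0 e0 nu0 ae.
have := ge0_ler_powR (_ : 0 <= nu^-1) _ _ ae; rewrite -powRrM divff ?gt_eqF //.
by rewrite powRr1 //; apply; rewrite ?nnegrE ?powR_ge0 // invr_ge0 ltW.
Qed.

Lemma le_powR_inv (R : realType) (a b nu : R) :
  0 <= a -> 0 < nu -> a `^ nu <= b -> a <= b `^ nu^-1.
Proof.
move=> a0 nu0 ab; have b0 : 0 <= b by exact: le_trans (powR_ge0 _ _) ab.
have := ge0_ler_powR (_ : 0 <= nu^-1) _ _ ab; rewrite -powRrM divff ?gt_eqF //.
by rewrite powRr1 //; apply; rewrite ?nnegrE ?powR_ge0 // invr_ge0 ltW.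
Qed.

Lemma fst_fst_continuous (S T U : topologicalType) :
  continuous (fun q : S * T * U => q.1.1).
Proof. by move=> q; apply: (@cvg_comp _ _ _ fst fst _ (nbhs q.1)); exact: cvg_fst. Qed.

Lemma snd_fst_continuous (S T U : topologicalType) :
  continuous (fun q : S * T * U => q.1.2).
Proof.
move=> q; apply: (@cvg_comp _ _ _ fst snd _ (nbhs q.1)); first exact: cvg_fst.
exact: cvg_snd.
Qed.

Lemma pair_continuous (S T : topologicalType) (q : S) :
  continuous (fun t : T => (q, t)).
Proof.
move=> t W [[U V] /= [Uq Vt] UV].
apply: (@filterS _ (nbhs t) _ _ _ _ Vt) => s Vs; apply: (UV (q, s)).
by split => //=; exact: nbhs_singleton.
Qed.

Lemma convex_set_combination (R : realType) (M : lmodType R) (S : set M)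
    (x y : M) (t : R) :
  convex_set (S : set (convex_lmodType M)) -> S x -> S y -> 0 <= t <= 1 ->
  S (t *: x + (1 - t) *: y).
Proof.
move=> cS Sx Sy /andP[t0 t1].
exact: set_mem (cS x y (Itv01 t0 t1) (mem_set Sx) (mem_set Sy)).
Qed.

Lemma xget_set1 (T : choiceType) (x0 a : T) : xget x0 [set a] = a.
Proof. by case: xgetP => // /(_ a); case. Qed.

(** [u], [v] are two payoffs of one action and [u'], [v'] those of another one;
    the second payoff function prefers the other action, so the first one
    cannot prefer the first action by more than twice the error. *)
Lemma near_maxima_gap (R : realType) (u u' v v' e d : R) :
  - u + d <= - u' -> `|u - v| <= e -> `|u' - v'| <= e -> v <= v' -> d <= 2 * e.
Proof. by rewrite !ler_norml => ? /andP[? ?] /andP[? ?] ?; lra. Qed.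

Lemma join_player_cvg (R : realType) (n : nat) (d : 'I_n -> nat) (i : 'I_n)
    (T : Type) (F : set_system T) (FF : Filter F) (X : T -> 'rV[R]_(d i))
    (Y : T -> forall j : others i, 'rV[R]_(d (sval j))) x y :
  X @ F --> x -> (forall j, (fun q => Y q j) @ F --> y j) ->
  (fun q => join_player (T := fun j => 'rV[R]_(d j)) (X q) (Y q)
    : profile R d) @ F -->
  (join_player (T := fun j => 'rV[R]_(d j)) x y : profile R d).
Proof.
move=> Xx Yy; apply: (@prod_topology_cvg _ (fun j => 'rV[R]_(d j))
  ((fun q => join_player (T := fun j => 'rV[R]_(d j)) (X q) (Y q)) @ F)) => j.
suff : (fun q => join_player (T := fun j => 'rV[R]_(d j)) (X q) (Y q) j) @ F -->
    join_player (T := fun j => 'rV[R]_(d j)) x y j by [].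
have [e|ne] := eqVneq j i.
  subst j; rewrite join_player_same.
  by under eq_fun do rewrite join_player_same.
pose j' : others i := exist _ j ne.
have joinE u v : join_player (T := fun j => 'rV[R]_(d j)) u v j = v j'.
  exact: (@join_player_other _ (fun j => 'rV[R]_(d j)) i u v j').
rewrite joinE (_ : (fun q => _) = (fun q => Y q j')); last first.
  by apply/funext => q; rewrite joinE.
exact: (Yy j').
Qed.

Lemma join_player_in (R : realType) (n : nat) (d : 'I_n -> nat) (i : 'I_n)
    (S : forall j, set 'rV[R]_(d j))
    (x : 'rV[R]_(d i)) (y : forall j : others i, 'rV[R]_(d (sval j))) :
  S i x -> (forall j, S (sval j) (y j)) ->
  forall j, S j (join_player (T := fun j => 'rV[R]_(d j)) x y j).
Proof.
move=> Sx Sy j; have [e|ne] := eqVneq j i; first by subst j; rewrite join_player_same.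
pose j' : others i := exist _ j ne.
by rewrite (@join_player_other _ (fun j => 'rV[R]_(d j)) i x y j'); exact: (Sy j').
Qed.

Section Game.
Variables (R : realType) (n : nat) (G : bayesian_game R n).
Local Notation act i := ('rV[R]_(adim G i)).
Local Notation typ i := ('rV[R]_(tdim G i)).

(** A profile of strategies is encoded as the family of its real coordinates,
    indexed by a player, a type and a component of the action: this is the
    power of the reals in which the fixed point is sought. *)
Definition strategy_index : choiceType :=
  {i : 'I_n & (typ i * 'I_(adim G i))%type}.

Definition index_of (i : 'I_n) (t : typ i) (c : 'I_(adim G i)) : strategy_index :=
  existT _ i (t, c).

Definition strategy (x : {ptws strategy_index -> R}) (i : 'I_n) (t : typ i) : act i :=
  \row_c x (index_of i t c).

Definition opponents (x : {ptws strategy_index -> R}) (i : 'I_n) :=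
  drop_player (fun j => typ j -> act j) i (strategy x).

Variables (alpha nu tau : 'I_n -> R).
Hypotheses (alpha_gt0 : forall i, 0 < alpha i) (nu_gt0 : forall i, 0 < nu i).
Hypothesis (tau_gt0 : forall i, 0 < tau i).

(** The modulus which the stability estimate gives to best responses when
    payoffs vary by at most [tau i * s]. *)
Definition modulus (i : 'I_n) (s : R) : R :=
  (2 * tau i / alpha i * s) `^ (nu i)^-1.

(** Fixing the value 0 outside the type sets makes every coordinate bounded,
    which compactness requires. *)
Definition equi_strategies : set {ptws strategy_index -> R} :=
  [set x | [/\ forall i t, tset G i t -> aset G i (strategy x i t),
    forall i t t' c, tset G i t -> tset G i t' ->
      `|x (index_of i t c) - x (index_of i t' c)|
        <= modulus i (eucl_norm (t - t'))
    & forall i t c, ~ tset G i t -> x (index_of i t c) = 0]].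

Local Notation K := equi_strategies.

Hypothesis utility_continuous : forall i : 'I_n,
  {within action_profiles G `*` type_profiles G, continuous (utility G i)}.
Hypothesis rho_quasi_concave : forall (i : 'I_n) f ti,
  other_behaviours G i f -> tset G i ti ->
  strictly_quasi_concave (aset G i) (fun ai => rho G i ai f ti).
Hypothesis growth : forall i f ti,
  other_behaviours G i f -> tset G i ti -> forall a', aset G i a' ->
  - rho G i a' f ti >= - best_value G i f ti +
    alpha i * eucl_dist a' (best_responses G i f ti) `^ nu i.
Hypothesis rho_lipschitz : forall i ai f ti ti',
  aset G i ai -> other_behaviours G i f -> tset G i ti -> tset G i ti' ->
  `|rho G i ai f ti - rho G i ai f ti'| <= tau i * eucl_norm (ti - ti').
Hypothesis sets_compact_convex : forall i : 'I_n,
  [/\ compact (aset G i), convex_set (aset G i),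
      compact (tset G i) & convex_set (tset G i)].

Let aset_compact i : compact (aset G i).
Proof. by case: (sets_compact_convex i). Qed.

Let tset_compact i : compact (tset G i).
Proof. by case: (sets_compact_convex i). Qed.

Lemma modulus_ge0 i s : 0 <= modulus i s.
Proof. exact: powR_ge0. Qed.

Lemma lipschitz_gt0 i : 0 < 2 * tau i / alpha i.
Proof. by rewrite divr_gt0 // mulr_gt0. Qed.

Lemma modulus_le i s e : 0 <= s -> 0 <= e ->
  s <= e `^ nu i / (2 * tau i / alpha i) -> modulus i s <= e.
Proof.
move=> s0 e0; rewrite ler_pdivlMr ?lipschitz_gt0 // mulrC => se.
by apply: powR_inv_le => //; rewrite mulr_ge0 // ltW // lipschitz_gt0.
Qed.

Lemma modulus_threshold_gt0 i (e : R) : 0 < e ->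
  0 < e `^ nu i / (2 * tau i / alpha i).
Proof. by move=> e0; rewrite divr_gt0 ?powR_gt0 ?lipschitz_gt0. Qed.

(** Evaluation is jointly continuous on profiles with a common modulus: moving
    the type costs at most the modulus, whichever the profile. *)
Lemma strategy_eval_cvg (T : Type) (F : set_system T) (FF : Filter F) i
    (X : T -> {ptws strategy_index -> R}) (Y : T -> typ i) x t :
  K x -> tset G i t ->
  (\forall q \near F, K (X q) /\ tset G i (Y q)) -> X @ F --> x -> Y @ F --> t ->
  (fun q => strategy (X q) i (Y q)) @ F --> strategy x i t.
Proof.
move=> Kx ti KXY Xx Yt; apply: row_cvg => c; apply/cvgrPdist_le => e e0.
have e2 : 0 < e / 2 by rewrite divr_gt0.
have near1 : \forall q \near F, `|x (index_of i t c) - X q (index_of i t c)| <= e / 2.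
  have : (fun q => X q (index_of i t c)) @ F --> x (index_of i t c).
    apply: (@cvg_comp _ _ _ X (fun y : {ptws strategy_index -> R} =>
      y (index_of i t c)) F (nbhs x)) => //.
    exact: (@ptws_coord_continuous _ R (index_of i t c) x).
  by move/cvgrPdist_le; apply.
have near2 : \forall q \near F, eucl_norm (t - Y q)
    < (e / 2) `^ nu i / (2 * tau i / alpha i).
  have : (fun q => eucl_norm (t - Y q)) @ F --> eucl_norm (t - t).
    apply: (@cvg_comp _ _ _ (fun q => t - Y q) (@eucl_norm R _) _ (nbhs (t - t))).
      by apply: cvgB => //; exact: cvg_cst.
    exact: eucl_norm_continuous.
  rewrite subrr eucl_norm0 => /cvgr_lt; apply.
  exact: modulus_threshold_gt0.
near=> q; rewrite !mxE.
have [KX tY] : K (X q) /\ tset G i (Y q) by near: q.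
apply: (le_trans (ler_distD (X q (index_of i t c)) _ _)); rewrite (splitr e).
apply: lerD; first by near: q.
have [_ lip _] := KX; apply: (le_trans (lip _ _ _ _ ti tY)).
apply: modulus_le; [exact: eucl_norm_ge0|exact: ltW|].
by apply: ltW; near: q.
Unshelve. all: by end_near. Qed.

Lemma strategy_continuous x i : K x -> {within tset G i, continuous (strategy x i)}.
Proof.
move=> Kx; apply/subspace_continuousP => t ti.
apply: (@strategy_eval_cvg _ (within (tset G i) (nbhs t)) _ i (fun=> x) id) => //.
- by apply: (@filterS _ (nbhs t) _ setT) => //; exact: filterT.
- exact: cvg_cst.
- by move=> W Wt; exact: filterS Wt.
Qed.

Lemma strategy_behaviour x i : K x -> behaviour G i (strategy x i).
Proof.
move=> Kx; split; last by case: Kx => Ka _ _; exact: Ka.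
by apply: continuous_measurable_borel; exact: strategy_continuous.
Qed.

Lemma opponents_behaviours x i : K x -> other_behaviours G i (opponents x i).
Proof. by move=> Kx j; exact: strategy_behaviour. Qed.

(** * Continuity of expected payoffs *)

Definition game_input (i : 'I_n) (ti : typ i)
    (q : ({ptws strategy_index -> R} * act i) *
         profile R (fun j : others i => tdim G (sval j)))
    : profile R (adim G) * profile R (tdim G) :=
  (join_player (T := fun j => act j) q.1.2
     (fun j => opponents q.1.1 i j (q.2 j)),
   join_player (T := fun j => typ j) ti q.2).

Lemma game_input_in i ti q : tset G i ti ->
  ((K `*` aset G i) `*` other_types G i) q ->
  (action_profiles G `*` type_profiles G) (game_input i ti q).
Proof.
move=> tiP [[/= [Ka _ _] qa] qt]; split => /=.
  by apply: (@join_player_in R n (adim G) i (aset G)) => // j; apply: Ka; exact: qt.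
exact: (@join_player_in R n (tdim G) i (tset G)).
Qed.

Lemma game_input_continuous i ti : tset G i ti ->
  {within (K `*` aset G i) `*` other_types G i, continuous (game_input i ti)}.
Proof.
move=> tiP; apply/subspace_continuousP => p pD.
set D := (_ `*` _ `*` _); pose F := within D (nbhs p).
have FF : Filter F by exact: within_filter.
have q1 : (fun q => q.1.1) @ F --> p.1.1.
  by apply: cvg_within_filter; exact: fst_fst_continuous.
have q2 : (fun q => q.1.2) @ F --> p.1.2.
  by apply: cvg_within_filter; exact: snd_fst_continuous.
have q3 j : (fun q => q.2 j) @ F --> p.2 j.
  apply: cvg_within_filter.
  apply: (@cvg_comp _ _ _ snd (fun t : profile R (fun j : others i =>
    tdim G (sval j)) => t j) _ (nbhs p.2)); first exact: cvg_snd.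
  exact: (@proj_continuous _ (fun j : others i => 'rV[R]_(tdim G (sval j))) j p.2).
have [[Kp _] tp] := pD.
have actc : (fun q => (game_input i ti q).1) @ F --> (game_input i ti p).1.
  apply: (join_player_cvg R n (adim G) i _ F FF (fun q => q.1.2)
    (fun q j => opponents q.1.1 i j (q.2 j))) => // j.
  apply: (strategy_eval_cvg _ F FF (sval j) (fun q => q.1.1) (fun q => q.2 j)) => //.
    have FD : F D by exact: withinT.
    by apply: filterS FD => q [[Kq _] tq]; split => //; exact: (tq j).
  exact: (q3 j).
have typc : (fun q => (game_input i ti q).2) @ F --> (game_input i ti p).2.
  apply: (join_player_cvg R n (tdim G) i _ F FF (fun=> ti) (fun q => q.2)) => //.
  exact: cvg_cst.
exact: (cvg_pair actc typc).
Qed.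

Lemma other_types_compact i : compact (other_types G i).
Proof.
apply: (@tychonoff _ (fun j : others i => 'rV[R]_(tdim G (sval j)))
  (fun j => tset G (sval j))) => j.
exact: tset_compact.
Qed.

Lemma other_types_measurable i :
  measurable (other_types G i :
    set (borel (profile R (fun j : others i => tdim G (sval j))))).
Proof.
rewrite -[X in measurable X]setCK; apply: measurableC.
apply: open_measurable_borel; rewrite openC.
have -> : other_types G i = \bigcap_(j : others i)
    (fun t : profile R (fun j : others i => tdim G (sval j)) => t j) @^-1`
      tset G (sval j).
  by apply/seteqP; split => t /= tP j; [move=> _; exact: tP|exact: tP].
apply: closed_bigI => j _; apply: closed_comp.
  move=> t _.
  exact: (@proj_continuous _ (fun j : others i => 'rV[R]_(tdim G (sval j))) j t).
by apply: compact_closed (tset_compact _); exact: norm_hausdorff.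
Qed.

Lemma payoff_continuous i ti : tset G i ti ->
  {within (K `*` aset G i) `*` other_types G i,
    continuous (utility G i \o game_input i ti)}.
Proof.
move=> tiP; apply: within_continuous_comp (utility_continuous i).
  by move=> q; exact: game_input_in.
exact: game_input_continuous.
Qed.

(** The integrand is jointly continuous and the types of the opponents range
    over a compact set, so it changes uniformly little with profile and action. *)
Lemma rho_continuous i ti : tset G i ti ->
  {within K `*` aset G i,
    continuous (fun p => rho G i p.2 (opponents p.1 i) ti)}.
Proof.
move=> tiP; apply/subspace_continuousP => p pD; apply/cvgrPdist_le => e e0.
have sect q : (K `*` aset G i) q -> {within other_types G i,
    continuous (fun t => utility G i (game_input i ti (q, t)))}.
  move=> qD; apply: (within_continuous_comp _ _ _ _ _ (fun t => (q, t)) _ _ _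
    (payoff_continuous _ _ tiP)).
    by move=> t tD; split.
  by apply: continuous_subspaceT; exact: pair_continuous.
have := within_continuous_near_compact _ _ _ _ _ _ _ _ (other_types_compact i)
  (payoff_continuous _ _ tiP) pD e0.
have inD : \forall q \near within (K `*` aset G i) (nbhs p), (K `*` aset G i) q.
  exact: withinT.
move=> near_p; near=> q; rewrite distrC.
have qD : (K `*` aset G i) q by near: q.
apply: (@Rintegral_dist_le _ _ (belief G i ti) _ (other_types_measurable i)
  (other_types_compact i) _ _ _ (ltW e0) (sect _ qD) (sect _ pD)).
by near: q.
Unshelve. all: by end_near. Qed.

(** * Best responses and their stability *)

(** The midpoint of two distinct maximizers would be strictly better. *)
Lemma best_responses_unique x i ti : K x -> tset G i ti ->
  exists a, best_responses G i (opponents x i) ti = [set a].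
Proof.
move=> Kx tiP; have fo := opponents_behaviours x i Kx.
have rhoc : {within aset G i, continuous (fun a => rho G i a (opponents x i) ti)}.
  apply: (within_continuous_comp _ _ _ _ _ (fun a => (x, a)) _ _ _
    (rho_continuous i ti tiP)); first by move=> a aD; split.
  by apply: continuous_subspaceT; exact: pair_continuous.
have [a aA amax] := compact_EVT_max (aset_nonempty R n G i) (aset_compact i) rhoc.
exists a; apply/seteqP; split => [b [bA bmax]|_ ->]; last first.
  by split; [exact: set_mem|move=> b /mem_set; exact: amax].
apply: contrapT => /eqP ba; have {}aA := set_mem aA.
have half : 0 < (2^-1 : R) < 1 by lra.
have [_ cvx _ _] := sets_compact_convex i.
have mid : aset G i (2^-1 *: b + (1 - 2^-1) *: a).
  by apply: convex_set_combination => //; lra.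
have := rho_quasi_concave i _ ti fo tiP b a bA aA ba _ half.
rewrite ltNge le_min bmax //=; move/negP; apply.
by rewrite amax // mem_set.
Qed.

Definition best_response (x : {ptws strategy_index -> R}) i (t : typ i) : act i :=
  xget 0 (best_responses G i (opponents x i) t).

Lemma best_responsesE x i ti : K x -> tset G i ti ->
  best_responses G i (opponents x i) ti = [set best_response x i ti].
Proof.
move=> Kx tiP; have [a aE] := best_responses_unique x i ti Kx tiP.
by rewrite /best_response aE xget_set1.
Qed.

Lemma best_responseP x i ti : K x -> tset G i ti ->
  best_responses G i (opponents x i) ti (best_response x i ti).
Proof. by move=> Kx tiP; rewrite best_responsesE. Qed.

Lemma best_valueE x i ti : K x -> tset G i ti ->
  best_value G i (opponents x i) ti =
  rho G i (best_response x i ti) (opponents x i) ti.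
Proof.
move=> Kx tiP; rewrite /best_value /maxval.
have -> : argmax (aset G i) (fun a => rho G i a (opponents x i) ti) =
    [set best_response x i ti] by exact: best_responsesE.
by rewrite image_set1 xget_set1.
Qed.

(** The growth condition bounds the distance from a nearby maximizer by the
    payoff it loses, which is at most twice the difference of the payoffs. *)
Lemma best_response_stable x x' i t t' e : K x -> K x' ->
  tset G i t -> tset G i t' ->
  (forall a, aset G i a ->
    `|rho G i a (opponents x i) t - rho G i a (opponents x' i) t'| <= e) ->
  eucl_norm (best_response x' i t' - best_response x i t) <=
    (2 * e / alpha i) `^ (nu i)^-1.
Proof.
move=> Kx Kx' tP tP' close.
have [aA amax] := best_responseP x i t Kx tP.
have [aA' amax'] := best_responseP x' i t' Kx' tP'.
apply: le_powR_inv => //; first exact: eucl_norm_ge0.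
have := growth i _ t (opponents_behaviours x i Kx) tP _ aA'.
rewrite best_valueE // best_responsesE // eucl_dist_set1 => gr.
rewrite ler_pdivlMr // mulrC.
exact: near_maxima_gap gr (close _ aA) (close _ aA') (amax' _ aA).
Qed.

Definition reply (x : {ptws strategy_index -> R}) : {ptws strategy_index -> R} :=
  fun j => let: existT i (t, c) := j in
    if `[< tset G i t >] then best_response x i t 0 c else 0.

Lemma strategy_reply x i t : tset G i t ->
  strategy (reply x) i t = best_response x i t.
Proof.
by move=> tP; apply/rowP => c; rewrite mxE /=; case: asboolP.
Qed.

Lemma best_response_modulus x i t t' : K x -> tset G i t -> tset G i t' ->
  eucl_norm (best_response x i t' - best_response x i t) <=
    modulus i (eucl_norm (t - t')).
Proof.
move=> Kx tP tP'; have -> : modulus i (eucl_norm (t - t')) =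
    (2 * (tau i * eucl_norm (t - t')) / alpha i) `^ (nu i)^-1.
  by rewrite /modulus; congr (_ `^ _); ring.
apply: best_response_stable => // a aA.
by apply: rho_lipschitz => //; exact: opponents_behaviours.
Qed.

Lemma reply_in x : K x -> K (reply x).
Proof.
move=> Kx; split => [i t tP|i t t' c tP tP'|i t c tP].
- by rewrite strategy_reply //; have [] := best_responseP x i t Kx tP.
- rewrite /=; case: asboolP => // _; case: asboolP => // _.
  apply: le_trans (best_response_modulus x i t t' Kx tP tP').
  apply: le_trans (coord_le_eucl_norm _ _ _ c).
  by rewrite !mxE distrC.
- by rewrite /=; case: asboolP.
Qed.

(** Stability again, now for one type and two nearby profiles. *)
Lemma reply_continuous j : {within K, continuous (fun x => reply x j)}.
Proof.
case: j => i [t c] /=; case: asboolP => [tP|_]; last first.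
  by apply: continuous_subspaceT => x; exact: cst_continuous.
apply/subspace_continuousP => x Kx; apply/cvgrPdist_le => e e0.
(* the payoff error for which the stability estimate gives exactly [e] *)
pose e1 := alpha i * e `^ nu i / 2.
have e10 : 0 < e1 by rewrite divr_gt0 // mulr_gt0 // powR_gt0.
have near_rho := within_continuous_near_compact _ _ _ _ _ _ _ _ (aset_compact i)
  (rho_continuous i t tP) Kx e10.
have inK : \forall y \near within K (nbhs x), K y by exact: withinT.
near=> y.
have Ky : K y by near: y.
apply: (@le_trans _ _ ((2 * e1 / alpha i) `^ (nu i)^-1)); last first.
  rewrite (_ : 2 * e1 / alpha i = e `^ nu i); last first.
    by rewrite /e1; field; rewrite gt_eqF.
  by apply: powR_inv_le => //; [exact: powR_ge0|exact: ltW].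
rewrite distrC.
apply: (@le_trans _ _ (eucl_norm (best_response y i t - best_response x i t))).
  by apply: le_trans (coord_le_eucl_norm _ _ _ c); rewrite !mxE.
apply: best_response_stable => // a aA; rewrite distrC.
by move: a aA; near: y; exact: near_rho.
Unshelve. all: by end_near. Qed.

Lemma equi_strategies_nonempty : K !=set0.
Proof.
pose a i := projT1 (cid (aset_nonempty R n G i)).
have aP i : aset G i (a i) by rewrite /a; case: cid.
exists (fun j : strategy_index => let: existT i (t, c) := j in
  if `[< tset G i t >] then a i 0 c else 0).
split => [i t tP|i t t' c tP tP'|i t c tP].
- rewrite (_ : strategy _ _ _ = a i) //; apply/rowP => c.
  by rewrite mxE /=; case: asboolP.
- rewrite /=; case: asboolP => // _; case: asboolP => // _.
  by rewrite subrr normr0 modulus_ge0.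
- by rewrite /=; case: asboolP.
Qed.

(** * Existence of the equilibrium *)

Lemma equi_strategies_convex : pointwise_convex R strategy_index K.
Proof.
move=> x y s [xa xl x0] [ya yl y0] s01; have /andP[s0 s1] := s01.
have s1' : 0 <= 1 - s by rewrite subr_ge0.
split => [i t tP|i t t' c tP tP'|i t c tP].
- rewrite (_ : strategy _ _ _ = s *: strategy x i t + (1 - s) *: strategy y i t).
    have [_ cvx _ _] := sets_compact_convex i.
    by apply: convex_set_combination => //; [exact: xa|exact: ya].
  by apply/rowP => c; rewrite !mxE.
- set b := modulus _ _; set a1 := x _; set a2 := y _; set a3 := x _; set a4 := y _.
  rewrite (_ : _ - _ = s * (a1 - a3) + (1 - s) * (a2 - a4)); last by ring.
  rewrite (_ : b = s * b + (1 - s) * b); last by ring.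
  apply: (le_trans (ler_normD _ _)); rewrite !normrM (ger0_norm s0) (ger0_norm s1').
  by apply: lerD; apply: ler_wpM2l => //; [exact: xl|exact: yl].
- by rewrite x0 // y0 // !mulr0 addr0.
Qed.

Lemma strategy_at_continuous i t :
  continuous (fun x : {ptws strategy_index -> R} => strategy x i t).
Proof.
move=> x; apply: (row_cvg _ _ _ (nbhs x)
  (fun x : {ptws strategy_index -> R} => strategy x i t)) => c.
have coordE : (fun y : {ptws strategy_index -> R} => strategy y i t 0 c) =
    (fun y => y (index_of i t c)) by apply/funext => y; rewrite mxE.
rewrite coordE mxE.
exact: (@ptws_coord_continuous _ R (index_of i t c) x).
Qed.

Lemma equi_strategies_closed : closed K.
Proof.
have coordc j : continuous (fun x : {ptws strategy_index -> R} => x j).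
  exact: ptws_coord_continuous.
have -> : K =
    (\bigcap_(i : 'I_n) \bigcap_(t in tset G i)
       (fun x : {ptws strategy_index -> R} => strategy x i t) @^-1` aset G i) `&`
    (\bigcap_(i : 'I_n) \bigcap_(t in tset G i) \bigcap_(t' in tset G i)
       \bigcap_(c : 'I_(adim G i)) [set x : {ptws strategy_index -> R} |
         `|x (index_of i t c) - x (index_of i t' c)| <=
           modulus i (eucl_norm (t - t'))]) `&`
    (\bigcap_(i : 'I_n) \bigcap_(t in ~` tset G i) \bigcap_(c : 'I_(adim G i))
       [set x : {ptws strategy_index -> R} | `|x (index_of i t c)| <= 0]).
  apply/seteqP; split => x.
    move=> [xa xl x0]; split; first split.
    - by move=> i _ t tP; exact: xa.
    - by move=> i _ t tP t' tP' c _; exact: xl.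
    - by move=> i _ t tP c _ /=; rewrite x0 // normr0.
  move=> [[xa xl] x0]; split.
  - by move=> i t tP; exact: xa.
  - by move=> i t t' c tP tP'; exact: xl.
  - move=> i t c tP; apply/eqP; rewrite -normr_le0.
    exact: (x0 i Logic.I t tP c Logic.I).
apply: closedI; first apply: closedI.
- apply: closed_bigI => i _; apply: closed_bigI => t _; apply: closed_comp.
    by move=> x _; exact: strategy_at_continuous.
  by apply: compact_closed (aset_compact i); exact: norm_hausdorff.
- apply: closed_bigI => i _; apply: closed_bigI => t _; apply: closed_bigI => t' _.
  apply: closed_bigI => c _.
  apply: (@closed_le_fun R _ (fun x : {ptws strategy_index -> R} =>
    `|x (index_of i t c) - x (index_of i t' c)|) (fun=> _)); last first.
    exact: cst_continuous.
  move=> x; apply: (@cvg_norm _ _ _ (nbhs x) _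
    (fun x : {ptws strategy_index -> R} =>
    x (index_of i t c) - x (index_of i t' c))).
  by apply: cvgB; exact: coordc.
- apply: closed_bigI => i _; apply: closed_bigI => t _.
  apply: closed_bigI => c _.
  apply: (@closed_le_fun R _ (fun x : {ptws strategy_index -> R} =>
    `|x (index_of i t c)|) (fun=> _)); last exact: cst_continuous.
  move=> x; apply: (@cvg_norm _ _ _ (nbhs x) _
    (fun x : {ptws strategy_index -> R} =>
    x (index_of i t c))).
  exact: coordc.
Qed.

Lemma equi_strategies_compact : compact K.
Proof.
have bound i c : exists M : R, 0 <= M /\ forall a, aset G i a -> `|a 0 c| <= M.
  have coordc : {within aset G i, continuous (fun a : act i => `|a 0 c|)}.
    apply: continuous_subspaceT => a.
    apply: (@cvg_norm _ _ _ (nbhs a) _ (fun a : act i => a 0 c)).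
    exact: coord_continuous.
  have [m _ mP] := compact_EVT_max (aset_nonempty R n G i) (aset_compact i) coordc.
  by exists `|m 0 c|; split => // a /mem_set; exact: mP.
pose M i c := projT1 (cid (bound i c)).
have MP i c : 0 <= M i c /\ forall a, aset G i a -> `|a 0 c| <= M i c.
  by rewrite /M; case: cid.
apply: (@subclosed_compact _ _ [set x : {ptws strategy_index -> R} | forall j,
  `|x j| <= (let: existT i (t, c) := j in M i c)]).
- exact: equi_strategies_closed.
- exact: (@ptws_box_compact R strategy_index
    (fun j => let: existT i (t, c) := j in M i c)).
- move=> x [xa _ x0] [i [t c]].
  have [tP|tP] := pselect (tset G i t).
    by have := (MP i c).2 _ (xa i t tP); rewrite mxE.
  by have := x0 i t c tP; rewrite /index_of => ->; rewrite normr0; have [] := MP i c.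
Qed.

Lemma equilibrium_strategy :
  exists x, [/\ K x, forall i t, tset G i t ->
      best_responses G i (opponents x i) t (strategy x i t)
    & forall i t t', tset G i t -> tset G i t' ->
      eucl_norm (strategy x i t' - strategy x i t) <=
        modulus i (eucl_norm (t - t'))].
Proof.
have [x Kx xfix] := tychonoff_fixpoint R strategy_index K reply
  equi_strategies_nonempty equi_strategies_compact equi_strategies_convex
  reply_in reply_continuous.
have xE i t : tset G i t -> strategy x i t = best_response x i t.
  by move=> tP; rewrite -[in LHS]xfix strategy_reply.
exists x; split => // [i t tP|i t t' tP tP'].
  by rewrite xE //; exact: best_responseP.
by rewrite !xE //; exact: best_response_modulus.
Qed.

End Game.

Theorem theorem3p2 (R : realType) (n : nat) (G : bayesian_game R n)
  (utility_continuous : forall i : 'I_n,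
    {within action_profiles G `*` type_profiles G, continuous (utility G i)})
  (rho_quasi_concave : forall (i : 'I_n) f ti,
    other_behaviours G i f -> tset G i ti ->
    strictly_quasi_concave (aset G i) (fun ai => rho G i ai f ti))
  (belief_continuous : forall (i : 'I_n)
      (S : set (borel (profile R (fun j : others i => tdim G (sval j))))),
    measurable S -> S `<=` other_types G i ->
    {within tset G i, continuous (fun ti => fine (belief G i ti S))})
  (growth : forall i : 'I_n, exists alpha nu : R, [/\ 0 < alpha, 0 < nu &
    forall f ti, other_behaviours G i f -> tset G i ti ->
    forall a', aset G i a' ->
      - rho G i a' f ti >=
      - best_value G i f ti + alpha * eucl_dist a' (best_responses G i f ti) `^ nu])
  (rho_lipschitz : forall i : 'I_n, exists2 tau : R, 0 < tau &
    forall ai f ti ti', aset G i ai -> other_behaviours G i f ->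
      tset G i ti -> tset G i ti' ->
      `|rho G i ai f ti - rho G i ai f ti'| <= tau * eucl_norm (ti - ti'))
  (sets_compact_convex : forall i : 'I_n,
    [/\ compact (aset G i), convex_set (aset G i),
        compact (tset G i) & convex_set (tset G i)]) :
  exists f : forall i : 'I_n, 'rV[R]_(tdim G i) -> 'rV[R]_(adim G i),
    [/\ forall i, behaviour G i (f i),
        forall i ti, tset G i ti ->
          argmax (aset G i)
            (fun ai => rho G i ai
              (drop_player
                 (fun j => 'rV[R]_(tdim G j) -> 'rV[R]_(adim G j)) i f) ti)
            (f i ti)
      & forall eps : R, 0 < eps -> exists2 delta : R, 0 < delta &
          forall (i : 'I_n) t' t'', tset G i t' -> tset G i t'' ->
            eucl_norm (t' - t'') < delta -> eucl_norm (f i t' - f i t'') <= eps].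
Proof.
pose alpha i := projT1 (cid (growth i)).
pose nu i := projT1 (cid (projT2 (cid (growth i)))).
pose tau i := projT1 (cid2 (rho_lipschitz i)).
have growthP i : [/\ 0 < alpha i, 0 < nu i & forall f ti,
    other_behaviours G i f -> tset G i ti -> forall a', aset G i a' ->
    - rho G i a' f ti >= - best_value G i f ti +
      alpha i * eucl_dist a' (best_responses G i f ti) `^ nu i].
  exact: projT2 (cid (projT2 (cid (growth i)))).
have tauP i : 0 < tau i /\ forall ai f ti ti',
    aset G i ai -> other_behaviours G i f -> tset G i ti -> tset G i ti' ->
    `|rho G i ai f ti - rho G i ai f ti'| <= tau i * eucl_norm (ti - ti').
  by rewrite /tau; case: cid2.
have alpha0 i : 0 < alpha i by case: (growthP i).
have nu0 i : 0 < nu i by case: (growthP i).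
have tau0 i : 0 < tau i by case: (tauP i).
have grow i f ti : other_behaviours G i f -> tset G i ti -> forall a', aset G i a' ->
    - rho G i a' f ti >= - best_value G i f ti +
      alpha i * eucl_dist a' (best_responses G i f ti) `^ nu i.
  by case: (growthP i) => _ _; apply.
have lip i := (tauP i).2.
have [x [Kx xP xM]] := equilibrium_strategy R n G alpha nu tau alpha0 nu0 tau0
  utility_continuous rho_quasi_concave grow lip sets_compact_convex.
exists (strategy R n G x); split => //.
  by move=> i; exact: (strategy_behaviour R n G alpha nu tau).
move=> eps eps0; pose delta i := eps `^ nu i / (2 * tau i / alpha i).
exists (\big[Num.min/1]_i delta i).
  by apply/bigmin_gtP; split => // i _; exact: modulus_threshold_gt0.
move=> i t t' tP tP' tt'; apply: (le_trans (xM i t' t tP' tP)).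
have sym : eucl_norm (t' - t) = eucl_norm (t - t').
  rewrite /eucl_norm; congr Num.sqrt; apply: eq_bigr => c _.
  by rewrite !mxE -sqrrN opprB.
rewrite sym; apply: modulus_le => //; [exact: eucl_norm_ge0|exact: ltW|].
by apply: ltW; apply: lt_le_trans tt' _; exact: bigmin_le.
Qed.
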